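(* Let $M$ be a Riemann surface, $\varphi\colon M\to\mathbb{R}^3$ a conformal immersion, and $\omega=2\partial\varphi\in\Omega^{1,0}(M,\mathbb{C}^3)$ its Weierstrass representation. The following are equivalent: (i) $\varphi$ is minimal; (ii) $\varphi$ is harmonic; (iii) $\omega$ is holomorphic; (iv) the bundle map $(\omega,\eta)$ from $TM\to M$ to $\mathcal{O}_{[Q]}(-1)\to[Q]$ is holomorphic; (v) the Gauss map $\eta\colon M\to\mathbb{S}^2$ of $\varphi$ is holomorphic.
   Context: A Riemann surface $M$ has complex structure $I\colon TM\to TM$, hence an orientation and a conformal class of Riemannian metrics (those for which $I$ is orthogonal). $TM$ is regarded as a holomorphic line bundle via $TM\cong T^{1,0}M$. An immersion $\varphi\colon M\to\mathbb{R}^3$ is conformal if each $d\varphi_p$ is conformal with respect to this class and the Euclidean metric. Harmonicity of functions on $M$ (here componentwise for $\varphi$) does not depend on the metric chosen in the conformal class. A conformal immersion is minimal if its mean curvature vanishes identically. The Weierstrass representation of $\varphi$ is the $\mathbb{C}^3$-valued $(1,0)$-form $\omega=2\partial\varphi$, $\omega(v)=d\varphi(v)-i\,d\varphi(Iv)$. It is nowhere vanishing and takes values in $Q=\{w\in\mathbb{C}^3: w_1^2+w_2^2+w_3^2=0\}$. Let $[Q]\subset\mathbb{C}P^2$ be the conic that is the projectivization of $Q$, and $\mathcal{O}_{[Q]}(-1)\subset[Q]\times\mathbb{C}^3$ its tautological line bundle. Then $\omega$ is the same as a smooth $\mathbb{C}$-linear, fiberwise isomorphic bundle map $(\omega,\eta)$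 from $TM\to M$ to $\mathcal{O}_{[Q]}(-1)\to[Q]$, where $\eta(p)=\omega(T_pM)\in[Q]$. The Gauss map of $\varphi$ sends $p$ to the unit normal $n$ such that $(d\varphi(v),d\varphi(Iv),n)$ is a positively oriented basis of $\mathbb{R}^3$ for $0\neq v\in T_pM$. The sphere $\mathbb{S}^2$ is a Riemann surface via the identification $\mathbb{S}^2\cong\mathbb{C}P^1$, $(x,y,z)\mapsto[1-z:x+iy]$ for $z\ne1$, $(0,0,1)\mapsto[0:1]$ (equivalently: the round conformal structure with the orientation given by the inward-pointing normal). Under this identification and $\mathbb{C}P^1\cong[Q]$, $[z_0:z_1]\mapsto[z_0^2-z_1^2:i(z_0^2+z_1^2):2z_0z_1]$, the Gauss map is the map $\eta$ above. *)

(* Defs.v *)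
From HB Require Import structures.
From mathcomp Require Import all_boot all_order all_algebra.
From mathcomp Require Import all_classical all_reals all_analysis.
From mathcomp Require Import complex.

Set Implicit Arguments.
Unset Strict Implicit.
Unset Printing Implicit Defensive.

Import Order.TTheory GRing.Theory Num.Theory.
Import numFieldNormedType.Exports.

Local Open Scope classical_set_scope.
Local Open Scope ring_scope.

(* [R[i]] packaged as a numClosedFieldType, so that the norm and topology which
   MathComp-Analysis puts on every numFieldType apply; over this scalar field
   [differentiable], [derivable] and [derive1] are complex differentiability and
   the complex derivative. *)
Definition Cx (R : realType) : numClosedFieldType := R[i].

Definition toCx (R : realType) (x : R) : Cx R := Complex x 0.
Definition mkCx (R : realType) (x y : R) : Cx R := Complex x y.
Definition reC (R : realType) (z : Cx R) : R := complex.Re z.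
Definition imC (R : realType) (z : Cx R) : R := complex.Im z.

Section RealCalculus.
Variables (R : realType) (W : normedModType R).
Implicit Types (h : Cx R -> W) (v z : Cx R).

(* A function of [z = x + i y] read as a function of [(x, y)]. *)
Definition realify h (u : R * R) : W := h (mkCx u.1 u.2).

Definition rderive v h z : W :=
  'D_((reC v, imC v) : R * R) (realify h) ((reC z, imC z) : R * R).

Definition iter_rderive (s : seq (Cx R)) h : Cx R -> W := foldr rderive h s.

(* C^oo on an open [U]: all iterated directional derivatives, of every order,
   are Frechet differentiable over R on [U]. *)
Definition smooth_on (U : set (Cx R)) h :=
  forall (s : seq (Cx R)) z, U z ->
    differentiable (realify (iter_rderive s h)) ((reC z, imC z) : R * R).

Definition laplacian h z : W :=
  rderive 1 (rderive 1 h) z + rderive 'i (rderive 'i h) z.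

End RealCalculus.

Section Euclidean3.
Variable R : realType.

Definition dot3 (u v : 'rV[R]_3) : R := \sum_i u 0 i * v 0 i.

Definition sphere2 : set 'rV[R]_3 := [set n | dot3 n n = 1].

Definition det3 (u v w : 'rV[R]_3) : R :=
  \det (\matrix_(i < 3) nth 0 [:: u; v; w] i).

End Euclidean3.

(* A chart of [T] with values in [V]: domain, coordinate map, and inverse (only
   meaningful on the image of the domain). *)
Record chart (T V : Type) := Chart {
  cdom : set T;
  cmap : T -> V;
  cinv : V -> T
}.

Definition is_chart (T V : topologicalType) (c : chart T V) :=
  [/\ open (cdom c), open (cmap c @` cdom c),
      forall p, cdom c p -> cinv c (cmap c p) = p,
      forall p, cdom c p -> {for p, continuous (cmap c)} &
      forall p, cdom c p -> {for cmap c p, continuous (cinv c)}].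

(* Holomorphy of a map between sets carrying complex atlases [A] and [B]. The
   requirement that [F] locally maps into the domain of [d] is continuity of [F]
   for the manifold topology defined by [B]. *)
Definition holomorphic (R : realType) (T T' : Type)
    (V V' : normedModType (Cx R)) (A : set (chart T V)) (B : set (chart T' V'))
    (F : T -> T') :=
  forall p c, A c -> cdom c p ->
    (exists d, B d /\ cdom d (F p)) /\
    (forall d, B d -> cdom d (F p) ->
       \forall z \near cmap c p,
         cdom d (F (cinv c z)) /\
         differentiable (cmap d \o F \o cinv c) z).

(* Holomorphy of a map into a complex submanifold [S] of the manifold with atlas
   [B]: the complex structure of [S] is the one induced from the ambient
   manifold. *)
Definition holomorphic_into (R : realType) (T T' : Type)
    (V V' : normedModType (Cx R)) (A : set (chart T V)) (S : set T')
    (B : set (chart T' V')) (F : T -> T') :=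
  (forall p, S (F p)) /\ holomorphic A B F.

Definition prod_chart (T T' V V' : Type) (c : chart T V) (d : chart T' V') :
    chart (T * T') (V * V') :=
  Chart (cdom c `*` cdom d)
        (fun u => (cmap c u.1, cmap d u.2))
        (fun w => (cinv c w.1, cinv d w.2)).

Definition prod_atlas (T T' V V' : Type) (A : set (chart T V))
    (B : set (chart T' V')) : set (chart (T * T') (V * V')) :=
  [set e | exists c d, [/\ A c, B d & e = prod_chart c d]].

Definition id_atlas (V : Type) : set (chart V V) := [set Chart setT id id].

Section ProjectiveSpace.
Variables (R : realType) (n : nat).

(* The point [w] of CP^(n+1) is the line spanned by [w], as a subset. *)
Definition proj_point (w : 'rV[Cx R]_n.+2) : set 'rV[Cx R]_n.+2 :=
  [set a *: w | a in [set: Cx R]].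

Definition proj_of (Q : set 'rV[Cx R]_n.+2) : set (set 'rV[Cx R]_n.+2) :=
  [set proj_point w | w in [set w | Q w /\ w != 0]].

(* The vector with k-th entry 1 on a line not contained in [w_k = 0]. *)
Definition normalized (k : 'I_n.+2) (L : set 'rV[Cx R]_n.+2) : 'rV[Cx R]_n.+2 :=
  xget 0 [set w | L w /\ w 0 k = 1].

(* [w] |-> (w_j / w_k)_(j != k) where w_k != 0. *)
Definition affine_chart (k : 'I_n.+2) :
    chart (set 'rV[Cx R]_n.+2) 'rV[Cx R]_n.+1 :=
  Chart [set proj_point w | w in [set w : 'rV[Cx R]_n.+2 | w 0 k != 0]]
        (fun L => col' k (normalized k L))
        (fun u =>
           proj_point (\row_j (if unlift k j is Some i then u 0 i else 1))).

Definition proj_atlas : set (chart (set 'rV[Cx R]_n.+2) 'rV[Cx R]_n.+1) :=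
  range affine_chart.

End ProjectiveSpace.

Section Conic.
Variable R : realType.

Definition null_quadric : set 'rV[Cx R]_3 := [set w | \sum_i w 0 i ^+ 2 = 0].

Definition conic : set (set 'rV[Cx R]_3) := proj_of null_quadric.

Definition conic_taut : set (set 'rV[Cx R]_3 * 'rV[Cx R]_3) :=
  [set u | conic u.1 /\ u.1 u.2].

(* (x, y, z) |-> [1 - z : x + i y], and (0, 0, 1) |-> [0 : 1]. *)
Definition sphere_to_CP1 (m : 'rV[R]_3) : set 'rV[Cx R]_2 :=
  let x := m 0 (inord 0) in let y := m 0 (inord 1) in let z := m 0 (inord 2) in
  if z == 1 then proj_point (\row_(j < 2) nth 0 [:: 0; 1] j)
  else proj_point (\row_(j < 2) nth 0 [:: toCx (1 - z); mkCx x y] j).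

End Conic.

Record riemann_surface (R : realType) := RiemannSurface {
  rs_carrier :> topologicalType;
  rs_hausdorff : hausdorff_space rs_carrier;
  rs_second_countable : @second_countable rs_carrier;
  rs_atlas : set (chart rs_carrier (Cx R));
  rs_chart : forall c, rs_atlas c -> is_chart c;
  rs_cover : forall p, exists c, rs_atlas c /\ cdom c p;
  rs_transition : forall c d, rs_atlas c -> rs_atlas d ->
    forall p, cdom c p -> cdom d p ->
      derivable (cmap d \o cinv c) (cmap c p) 1
}.

Section TangentBundle.
Variables (R : realType) (M : riemann_surface R).
Implicit Types (p : M) (c : chart M (Cx R)).

Definition chart_at p : chart M (Cx R) := projT1 (cid (rs_cover p)).

(* [T_pM] is modelled as the complex line [Cx R]: the number [v] stands for the
   tangent vector with coordinate [v] in the preferred chart [chart_at p], and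
   the complex structure [I] is multiplication by ['i]. *)
Definition tangent_bundle : Type := (M * Cx R)%type.

(* Factor from the coordinate of a tangent vector at [p] in [chart_at p] to its
   coordinate in [c], and conversely. The latter is also the coordinate vector
   field of [c], as an element of [T_pM]. *)
Definition to_chart c p : Cx R :=
  derive1 (cmap c \o cinv (chart_at p)) (cmap (chart_at p) p).
Definition of_chart c p : Cx R :=
  derive1 (cmap (chart_at p) \o cinv c) (cmap c p).

Definition tangent_chart c : chart tangent_bundle (Cx R * Cx R) :=
  Chart [set u | cdom c u.1]
        (fun u => (cmap c u.1, to_chart c u.1 * u.2))
        (fun w => (cinv c w.1, of_chart c (cinv c w.1) * w.2)).

Definition tangent_atlas : set (chart tangent_bundle (Cx R * Cx R)) :=
  tangent_chart @` @rs_atlas R M.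

(* Holomorphy of a (1,0)-form: in each chart [z] it is [f dz], [f] holomorphic. *)
Definition holomorphic_form (W : normedModType (Cx R)) (om : M -> Cx R -> W) :=
  forall c p, rs_atlas c -> cdom c p ->
    derivable (fun z : Cx R => om (cinv c z) (of_chart c (cinv c z)))
              (cmap c p) 1.

End TangentBundle.

Section ConformalImmersions.
Variables (R : realType) (M : riemann_surface R).
Variable phi : M -> 'rV[R]_3.
Implicit Types (p : M) (c : chart M (Cx R)) (v w : Cx R).

Definition dmap p v : 'rV[R]_3 :=
  rderive v (phi \o cinv (chart_at p)) (cmap (chart_at p) p).

Definition smooth_map :=
  forall c, rs_atlas c -> smooth_on (cmap c @` cdom c) (phi \o cinv c).

(* The inner products on [T_pM] for which ['i] is orthogonal are the positive
   multiples of [Re (v * conj w)]. *)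
Definition conformal_at p :=
  exists2 l : R, 0 < l &
    forall v w, dot3 (dmap p v) (dmap p w) = l * reC (v * w^* ).

Definition conformal_immersion :=
  smooth_map /\ forall p, injective (dmap p) /\ conformal_at p.

Definition gauss_map p : 'rV[R]_3 :=
  xget 0 [set n | [/\ dot3 n n = 1, forall v, dot3 n (dmap p v) = 0 &
                      forall v, v != 0 ->
                        0 < det3 (dmap p v) (dmap p ('i * v)) n]].

(* (e G - 2 f F + g E) / (2 (E G - F^2)), half the trace of the second
   fundamental form with respect to the first, in the real coordinates of [c]. *)
Definition mean_curvature c p : R :=
  let h := phi \o cinv c in let z := cmap c p in
  let hx := rderive 1 h z in let hy := rderive 'i h z in
  let E := dot3 hx hx in let F := dot3 hx hy in let G := dot3 hy hy in
  let e := dot3 (rderive 1 (rderive 1 h) z) (gauss_map p) in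
  let f := dot3 (rderive 1 (rderive 'i h) z) (gauss_map p) in
  let g := dot3 (rderive 'i (rderive 'i h) z) (gauss_map p) in
  (e * G - 2 * f * F + g * E) / (2 * (E * G - F ^+ 2)).

Definition minimal_immersion :=
  forall c p, rs_atlas c -> cdom c p -> mean_curvature c p = 0.

(* Harmonicity being conformally invariant, the metric |dz|^2 of a holomorphic
   coordinate may be used. *)
Definition harmonic_map :=
  forall c p, rs_atlas c -> cdom c p ->
    laplacian (phi \o cinv c) (cmap c p) = 0.

Definition weierstrass p v : 'rV[Cx R]_3 :=
  map_mx (@toCx R) (dmap p v) - 'i *: map_mx (@toCx R) (dmap p ('i * v)).

Definition eta_map p : set 'rV[Cx R]_3 := range (weierstrass p).

Definition weierstrass_bundle_map (u : tangent_bundle M) :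
    set 'rV[Cx R]_3 * 'rV[Cx R]_3 :=
  (eta_map u.1, weierstrass u.1 u.2).

(* The tautological bundle of the conic is a complex submanifold of
   CP^2 x C^3. *)
Definition holomorphic_bundle_map :=
  holomorphic_into (@rs_atlas R M) (@conic R) (@proj_atlas R 1) eta_map /\
  holomorphic_into (@tangent_atlas R M) (@conic_taut R)
    (prod_atlas (@proj_atlas R 1) (@id_atlas 'rV[Cx R]_3))
    weierstrass_bundle_map.

(* The complex structure of the sphere is pulled back from CP^1. *)
Definition holomorphic_gauss_map :=
  (forall p, sphere2 (gauss_map p)) /\
  holomorphic (@rs_atlas R M) (@proj_atlas R 0)
    (@sphere_to_CP1 R \o gauss_map).

End ConformalImmersions.

(* Main.v *)
(* In a chart with coordinate z = x + i y write h for phi, f = h_x - i h_y for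
   the coefficient of omega, and D = d/dx + i d/dy, so that a map is holomorphic
   iff it is real differentiable and killed by D. Symmetry of second derivatives
   gives D f = Laplacian h, a real vector. Conformality says f.f = 0; applying D
   yields f . (Laplacian h) = 0, so Laplacian h is normal to the surface, and its
   normal component is, up to a positive factor, the mean curvature. Hence (i),
   (ii) and (iii) are equivalent. Given (iii), the map (z, w) |-> ([f z], w f z)
   is holomorphic in affine charts. With n the unit normal, a direct computation
   with the frame (h_x, h_y, n) shows that the point of CP^1 defined by n is
   [f_0 - i f_1 : f_2] = [f_2 : - f_0 - i f_1], whence (v) from (iv). Finally, if
   the Gauss map is holomorphic, then f = a q with q holomorphic, so
   D f = (D a / a) f is orthogonal to n, and the mean curvature vanishes. *)
From HB Require Import structures.
Require Import Defs.
From mathcomp Require Import all_boot all_order all_algebra.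
From mathcomp Require Import all_classical all_reals all_analysis.
From mathcomp Require Import complex ring lra.

Set Implicit Arguments.
Unset Strict Implicit.
Unset Printing Implicit Defensive.

Import Order.TTheory GRing.Theory Num.Theory.
Import numFieldNormedType.Exports.

Local Open Scope classical_set_scope.
Local Open Scope ring_scope.

(** * Differentiability and symmetry of second derivatives *)

(** Two differential calculi meet on the same plane: complex derivatives on [Cx R], whose norm is
    itself complex valued, and real ones on [R * R]. The passage between them is made by explicit
    epsilon bounds and a comparison of the two norms. Smoothness is phrased by iterated directional
    derivatives, so the symmetry of second derivatives is obtained from plain differentiability, by
    comparing both of them with one second difference. A tangent vector is a number in a preferred
    chart, so statements are first moved to an arbitrary chart; that the change of coordinate is
    invertible is read off from the injectivity of the differential of [phi]. Holomorphy into a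
    projective space is produced from local lifts to nonzero vectors. For the sphere two formulas
    are needed, since each of the two homogeneous pairs degenerates to (0, 0) at one pole; they
    never do so together, because then [f] would vanish. In the last implication the factor [a] is
    one of the two numbers [- i f_1 + f_0], [- i f_1 - f_0], and [q] is a polynomial in the affine
    coordinate of the Gauss map. *)

Lemma diff_near (K : numFieldType) (V W : normedModType K) (f : V -> W) x :
  differentiable f x -> forall e, 0 < e ->
  \forall v \near 0, `|f (v + x) - f x - 'd f x v| <= e * `|v|.
Proof.
move=> /diff_locally/eqaddoP H e e0.
have := H e e0; apply: filterS => v.
rewrite /= -![(_ + _ : _ -> _) _]/(_ + _) -![(- _ : _ -> _) _]/(- _).
by rewrite /cst /= opprD addrA.
Qed.

(** Uniqueness of first-order expansions identifies the differential with the candidate [df]. The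
    hypothesis is an explicit bound because bounds, unlike little-o statements, can be carried
    between norms with values in different fields. *)
Lemma near_is_diff (K : numFieldType) (V W : normedModType K) (f : V -> W) x
    (df : {linear V -> W}) : continuous df ->
  (forall e, 0 < e ->
     \forall v \near 0, `|f (v + x) - f x - df v| <= e * `|v|) ->
  is_diff x f df.
Proof.
move=> cdf H.
have E : f \o shift x = cst (f x) + df +o_ 0 id.
  apply/eqaddoP => e e0; have := H e e0; apply: filterS => v.
  rewrite /= -![(_ + _ : _ -> _) _]/(_ + _) -![(- _ : _ -> _) _]/(- _).
  by rewrite /cst /= opprD addrA.
have dE := diff_unique cdf E.
by split => //; apply/diff_locallyP; rewrite dE.
Qed.

Section SecondDerivatives.
Variables (R : realType) (V : normedModType R).
Implicit Types (g : V -> R) (u v w : V).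

Lemma is_derive_line g u v (s : R) : differentiable g (s *: v + u) ->
  is_derive s 1 (fun r => g (r *: v + u)) ('D_v g (s *: v + u)).
Proof.
move=> dg.
have dl : is_diff s (fun r : R => r *: v + u) (fun r : R => r *: v).
  have -> : (fun r : R => r *: v + u) = *:%R^~ v + cst u by [].
  by apply: is_diff_eq; rewrite addr0.
have dg' := differentiableP dg.
have dc : is_diff s (g \o (fun r => r *: v + u)) ('d g (s *: v + u) \o (fun r : R => r *: v)).
  exact: is_diff_comp.
split; first exact/diff_derivable/ex_diff.
by rewrite deriveE ?diff_val /= ?scale1r ?deriveE //; exact: ex_diff.
Qed.

(* The left-hand side without its last term is symmetric in [v] and [w]; the
   estimate is the mean value theorem in the direction [v]. *)
Lemma second_difference g u v w (e : R) : 0 < e ->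
  (\forall y \near u, differentiable g y) -> differentiable ('D_v g) u ->
  \forall t \near 0^'+,
    `|g (t *: v + (t *: w + u)) - g (t *: v + u) - g (t *: w + u) + g u
      - t ^+ 2 * 'D_w ('D_v g) u| <= e * (t ^+ 2 * (2 * (`|v| + `|w|))).
Proof.
move=> e0 dg ddg.
have dg0 : \forall y \near 0, differentiable g (y + u).
  by move: dg; rewrite (near_shift 0); apply: filterS => y; rewrite /= subr0.
have /nbhs_normP[d /= d0 Hd] : \forall y \near (0 : V), differentiable g (y + u) /\
    `|'D_v g (y + u) - 'D_v g u - 'd ('D_v g) u y| <= e * `|y|.
  exact: filterI dg0 (diff_near ddg e0).
(* The summand 1 keeps the divisor below positive when [v] and [w] both vanish. *)
pose C := `|v| + `|w| + 1.
have C0 : 0 < C by rewrite ltr_wpDl // addr_ge0.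
near=> t.
have t0 : 0 < t by near: t; exact: nbhs_right_gt.
have small (y : V) : `|y| <= t * (`|v| + `|w|) -> differentiable g (y + u) /\
    `|'D_v g (y + u) - 'D_v g u - 'd ('D_v g) u y| <= e * `|y|.
  move=> yt; apply: Hd; rewrite /ball_ /= sub0r normrN.
  apply: le_lt_trans yt _.
  apply: (@le_lt_trans _ _ (t * C)); first by rewrite ler_pM2l // lerDl.
  by rewrite -ltr_pdivlMr //; near: t; apply: nbhs_right_lt; rewrite divr_gt0.
have bc c : 0 <= c <= t -> `|c *: v| <= t * (`|v| + `|w|).
  move=> /andP[c0 ct]; rewrite normrZ ger0_norm // mulrDr.
  by rewrite -[X in X <= _]addr0 lerD // ?ler_wpM2r // mulr_ge0 // ltW.
have bct c : 0 <= c <= t -> `|c *: v + t *: w| <= t * (`|v| + `|w|).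
  move=> /andP[c0 ct]; apply: le_trans (ler_normD _ _) _.
  by rewrite !normrZ !ger0_norm ?(ltW t0) // mulrDr lerD // ler_wpM2r.
pose k (s : R) := g (s *: v + (t *: w + u)) - g (s *: v + u).
pose dk (s : R) := 'D_v g (s *: v + (t *: w + u)) - 'D_v g (s *: v + u).
have isdk s : 0 <= s <= t -> is_derive s 1 k (dk s).
  move=> st; apply: is_deriveB; apply: is_derive_line.
  - by rewrite addrA; exact: (small _ (bct _ st)).1.
  - exact: (small _ (bc _ st)).1.
have [c] : exists2 c, c \in `]0, t[ & k t - k 0 = dk c * (t - 0).
  apply: MVT => // [s|].
    by rewrite in_itv /= => /andP[s0 st]; apply: isdk; rewrite !ltW.
  apply: derivable_within_continuous => s; rewrite in_itv /= => st.
  by case: (isdk s st).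
rewrite in_itv /= subr0 => /andP[c0 ct] kE.
have cin : 0 <= c <= t by rewrite !ltW.
have -> : g (t *: v + (t *: w + u)) - g (t *: v + u) - g (t *: w + u) + g u = k t - k 0.
  by rewrite /k !scale0r !add0r; ring.
have [_ B1] := small _ (bct _ cin); have [_ B2] := small _ (bc _ cin).
have -> : 'D_w ('D_v g) u = 'd ('D_v g) u w by rewrite deriveE.
move: B1 B2; rewrite kE /dk linearD addrA.
have -> : 'd ('D_v g) u (t *: w) = t *: 'd ('D_v g) u w by rewrite linearZ.
set A := 'D_v g (c *: v + t *: w + u); set B := 'D_v g (c *: v + u).
set L := 'd _ _ (c *: v); set L' := 'd _ _ w; set D := 'D_v g u.
move=> B1 B2.
(* The mean value point [c] is unknown, but its linear term [L] occurs in the expansions of both [A]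
   and [B] and cancels; only [t *: L'] survives. *)
have -> : (A - B) * t - t ^+ 2 * L' = t * ((A - D - (L + t *: L')) - (B - D - L)).
  rewrite -[t *: L']/(t * L'); ring.
rewrite normrM (gtr0_norm t0) expr2 mulrCA -mulrA ler_pM2l //.
apply: le_trans (ler_normB _ _) _; apply: le_trans (lerD B1 B2) _.
rewrite -mulrDr mulrCA ler_pM2l // mulrCA mulr2n mulrDl !mul1r.
by apply: lerD; [exact: bct|exact: bc].
Unshelve. all: by end_near. Qed.

(** The second difference does not change when [v] and [w] are exchanged, so both iterated
    derivatives, multiplied by [t ^+ 2], are close to the same number. This is Young's form of the
    symmetry theorem. *)
Lemma derive_sym g u v w : (\forall y \near u, differentiable g y) ->
  differentiable ('D_v g) u -> differentiable ('D_w g) u ->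
  'D_w ('D_v g) u = 'D_v ('D_w g) u.
Proof.
move=> dg dv dw; apply/eqP; rewrite -subr_eq0 -normr_le0.
apply/ler_addgt0Pl => e e0; rewrite addr0.
(* [C] exceeds the factor in the error term, so with [e / (2 * C)] each of the two estimates costs
   at most half of [e * t ^+ 2]. *)
pose C := 2 * (`|v| + `|w|) + 1.
have C0 : 0 < C by rewrite ltr_wpDl // mulr_ge0 // addr_ge0.
have e'0 : 0 < e / (2 * C) by rewrite divr_gt0 // mulr_gt0.
near (0 : R)^'+ => t.
have t0 : 0 < t by near: t; exact: nbhs_right_gt.
have t20 : 0 < t ^+ 2 by rewrite exprn_gt0.
have : `|g (t *: v + (t *: w + u)) - g (t *: v + u) - g (t *: w + u) + g u
      - t ^+ 2 * 'D_w ('D_v g) u| <= e / (2 * C) * (t ^+ 2 * (2 * (`|v| + `|w|))).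
  by near: t; exact: second_difference.
have : `|g (t *: w + (t *: v + u)) - g (t *: w + u) - g (t *: v + u) + g u
      - t ^+ 2 * 'D_v ('D_w g) u| <= e / (2 * C) * (t ^+ 2 * (2 * (`|w| + `|v|))).
  by near: t; exact: second_difference.
rewrite [t *: w + (t *: v + u)]addrCA [`|w| + _]addrC.
set X := 'D_w _ u; set Y := 'D_v _ u.
set P := g _ - g _ - g _ + g u; set Q := g _ - g _ - g _ + g u.
have {P} -> : P = Q by rewrite /P /Q; ring.
move: Q X Y => Q X Y H1 H2.
have H : `|X - Y| * t ^+ 2 <= e * t ^+ 2.
  rewrite -[X in _ * X <= _](gtr0_norm t20) -normrM.
  have -> : (X - Y) * t ^+ 2 = (Q - t ^+ 2 * Y) - (Q - t ^+ 2 * X) by ring.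
  apply: le_trans (ler_normB _ _) _; apply: le_trans (lerD H1 H2) _.
  rewrite -mulrDr -mulr2n -mulr_natl [leLHS](_ : _ =
    e / C * (2 * (`|v| + `|w|)) * t ^+ 2); last by field; exact: lt0r_neq0.
  by rewrite ler_pM2r // mulrAC ler_pdivrMr // ler_pM2l // lerDl.
by move: H; rewrite ler_pM2r.
Unshelve. all: by end_near. Qed.

End SecondDerivatives.

(** * Comparison of the complex line with the real plane *)

Section ComplexPlane.
Variable R : realType.
Implicit Types (z w : Cx R) (u v : R * R).

Definition plane z : R * R := (reC z, imC z).
Definition unplane u : Cx R := mkCx u.1 u.2.

Lemma planeK : cancel plane unplane. Proof. by case. Qed.
Lemma unplaneK : cancel unplane plane. Proof. by case. Qed.

Lemma reCD z w : reC (z + w) = reC z + reC w. Proof. by case: z w => [? ?] [? ?]. Qed.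
Lemma imCD z w : imC (z + w) = imC z + imC w. Proof. by case: z w => [? ?] [? ?]. Qed.
Lemma reCN z : reC (- z) = - reC z. Proof. by case: z. Qed.
Lemma imCN z : imC (- z) = - imC z. Proof. by case: z. Qed.
Lemma reCM z w : reC (z * w) = reC z * reC w - imC z * imC w.
Proof. by case: z w => [? ?] [? ?]. Qed.
Lemma imCM z w : imC (z * w) = reC z * imC w + imC z * reC w.
Proof. by case: z w => [? ?] [? ?]. Qed.
Lemma reC1 : reC (1 : Cx R) = 1. Proof. by []. Qed.
Lemma imC1 : imC (1 : Cx R) = 0. Proof. by []. Qed.
Lemma CxiE : ('i : Cx R) = mkCx 0 1. Proof. by rewrite -complexiE. Qed.
Lemma reCi : reC ('i : Cx R) = 0. Proof. by rewrite CxiE. Qed.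
Lemma imCi : imC ('i : Cx R) = 1. Proof. by rewrite CxiE. Qed.

Definition reimE := (reCD, imCD, reCN, imCN, reCM, imCM).

Lemma Cx_eqP z w : reC z = reC w -> imC z = imC w -> z = w.
Proof. by case: z w => [? ?] [? ?] /= -> ->. Qed.

Lemma planeD z w : plane (z + w) = plane z + plane w.
Proof. by rewrite /plane reCD imCD. Qed.
Lemma unplaneD u v : unplane (u + v) = unplane u + unplane v.
Proof. by []. Qed.

(** The norm of [Cx R] takes values in [Cx R]; this is the same number in [R], comparable with the
    norm of [R * R]. *)
Definition cnorm z : R := reC `|z|.

Lemma cnormE z : `|z| = toCx (cnorm z).
Proof. by rewrite /cnorm /toCx normc_def. Qed.

Lemma ler_toCx (x y : R) : (toCx x <= toCx y) = (x <= y).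
Proof. exact: lecR. Qed.
Lemma toCxD (x y : R) : toCx (x + y) = toCx x + toCx y.
Proof. by apply: Cx_eqP; rewrite ?reCD ?imCD /= ?addr0. Qed.
Lemma toCxM (x y : R) : toCx (x * y) = toCx x * toCx y.
Proof. by apply: Cx_eqP; rewrite !reimE /= ?mulr0 ?mul0r ?subr0 ?addr0. Qed.

Lemma gt0_toCx (e : Cx R) : 0 < e -> exists2 r : R, 0 < r & e = toCx r.
Proof.
case: e => a b; rewrite ltcE /= => /andP[/eqP -> a0].
by exists a.
Qed.

Lemma cnorm_re z : `|reC z| <= cnorm z.
Proof.
rewrite /cnorm normc_def /= -sqrtr_sqr ler_wsqrtr // lerDl sqr_ge0 //.
Qed.

Lemma cnorm_im z : `|imC z| <= cnorm z.
Proof.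
rewrite /cnorm normc_def /= -sqrtr_sqr ler_wsqrtr // lerDr sqr_ge0 //.
Qed.

Lemma cnorm_le z : cnorm z <= `|reC z| + `|imC z|.
Proof.
rewrite /cnorm normc_def /= -[X in _ <= X]ger0_norm ?addr_ge0 //.
rewrite -sqrtr_sqr ler_wsqrtr // sqrrD !real_normK ?num_real // lerD2r lerDl.
by rewrite mulrn_wge0 // mulr_ge0.
Qed.

Lemma cnorm_plane z : cnorm z <= 2 * `|plane z|.
Proof.
apply: le_trans (cnorm_le z) _; rewrite /plane prod_normE /= mulr2n mulrDl mul1r.
by rewrite lerD // le_max lexx ?orbT.
Qed.

Lemma plane_cnorm z : `|plane z| <= cnorm z.
Proof. by rewrite /plane prod_normE ge_max /= cnorm_re cnorm_im. Qed.

Lemma unplane_continuous : continuous unplane.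
Proof.
move=> u; apply/cvgrPdist_le => e /gt0_toCx[r r0 ->]; near=> v.
rewrite cnormE ler_toCx; apply: le_trans (cnorm_plane _) _.
have -> : plane (unplane u - unplane v) = u - v.
  by rewrite -[unplane u - _]/(unplane (u - v)) unplaneK.
rewrite -ler_pdivlMl // mulrC.
by near: v; apply: cvgr_dist_le => //; rewrite divr_gt0.
Unshelve. all: by end_near. Qed.

Lemma near_unplane (P : set (Cx R)) u :
  (\forall w \near unplane u, P w) -> \forall v \near u, P (unplane v).
Proof. exact: unplane_continuous. Qed.

Lemma plane_continuous : continuous plane.
Proof.
move=> z; apply/(@cvgrPdist_le _ _ _ _ (nbhs_filter z)) => e e0; near=> w.
have -> : plane z - plane w = plane (z - w) by rewrite planeD /plane !reimE.
apply: le_trans (plane_cnorm _) _; rewrite -ler_toCx -cnormE.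
near: w.
exact: (@cvgr_dist_le _ _ _ _ (nbhs_filter z) id z (@cvg_id _ (nbhs z))
  (toCx e) (etrans (ltcR 0 e) e0)).
Unshelve. all: by end_near. Qed.

Lemma near_plane (P : set (R * R)) z :
  (\forall v \near plane z, P v) -> \forall w \near z, P (plane w).
Proof. exact: plane_continuous. Qed.

(** The form a dx + b dy, made a linear map below so that it can serve as an explicit
    differential. *)
Definition plane_form (a b : R) u : R := u.1 * a + u.2 * b.

Lemma plane_form_is_linear a b : linear (plane_form a b).
Proof. by move=> k u v; rewrite /plane_form /= /GRing.scale /=; ring. Qed.

HB.instance Definition _ a b :=
  GRing.isLinear.Build R (R * R)%type R _ (plane_form a b) (plane_form_is_linear a b).

Lemma plane_form_continuous a b : continuous (plane_form a b).
Proof.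
move=> u; apply: cvgD; apply: cvgM.
- exact: cvg_fst.
- exact: cvg_cst.
- exact: cvg_snd.
- exact: cvg_cst.
Qed.

Lemma realify_plane (T : normedModType R) (h : Cx R -> T) z :
  realify h (plane z) = h z.
Proof. by rewrite /realify -/(unplane _) planeK. Qed.

Lemma realify_shift (T : normedModType R) (h : Cx R -> T) z v :
  realify h (v + plane z) = h (unplane v + z).
Proof. by rewrite /realify -/(unplane _) unplaneD planeK. Qed.

(** Real differentiability. [realify] is differentiated as a map into a normed space over [R],
    whereas [Cx R] is one over itself; hence the split into real and imaginary parts. *)
Definition cdifferentiable (f : Cx R -> Cx R) z :=
  differentiable (realify (@reC R \o f)) (plane z) /\
  differentiable (realify (@imC R \o f)) (plane z).

Definition cderive (v : Cx R) (f : Cx R -> Cx R) z : Cx R :=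
  mkCx (rderive v (@reC R \o f) z) (rderive v (@imC R \o f) z).

(* Twice the usual del-bar operator. *)
Definition dbar (f : Cx R -> Cx R) z : Cx R :=
  cderive 1 f z + 'i * cderive 'i f z.

Lemma derivable_near (f : Cx R -> Cx R) z : derivable f z 1 ->
  forall e : R, 0 < e ->
  \forall v \near (0 : R * R),
    cnorm (f (unplane v + z) - f z - unplane v * derive1 f z) <= e * `|v|.
Proof.
move=> df e e0; have /derivable1_diffP dff := df.
(* The factor 1/2 compensates for [cnorm_plane]: the complex modulus is at most twice the maximum
   norm of the pair. *)
have e20 : 0 < toCx (e / 2) by rewrite (ltcR 0) divr_gt0.
have := diff_near dff e20; rewrite deriv1E // => H.
have : \forall v \near (0 : R * R), (fun w => `|f (w + z) - f z - w *: derive1 f z| <=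
  toCx (e / 2) * `|w|) (unplane v).
  apply: (@near_unplane (fun w => `|f (w + z) - f z - w *: derive1 f z| <=
    toCx (e / 2) * `|w|) 0).
  by rewrite (_ : unplane 0 = 0) //; apply: Cx_eqP.
apply: filterS => v /=; rewrite !cnormE -toCxM ler_toCx => H'.
apply: le_trans H' _; apply: le_trans (_ : e / 2 * (2 * `|v|) <= _).
  rewrite ler_wpM2l ?divr_ge0 ?(ltW e0) //.
  by have := cnorm_plane (unplane v); rewrite unplaneK.
by rewrite mulrA divfK.
Qed.

(** The two forms are the real and imaginary parts of multiplication by the complex derivative; the
    Cauchy-Riemann equations are built into their coefficients. *)
Lemma derivable_is_diff (f : Cx R -> Cx R) z : derivable f z 1 ->
  is_diff (plane z) (realify (@reC R \o f))
    (plane_form (reC (derive1 f z)) (- imC (derive1 f z))) /\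
  is_diff (plane z) (realify (@imC R \o f))
    (plane_form (imC (derive1 f z)) (reC (derive1 f z))).
Proof.
move=> df; split; apply: near_is_diff; try exact: plane_form_continuous;
  move=> e e0; have := derivable_near df e0; apply: filterS => v;
  apply: le_trans; rewrite realify_shift realify_plane [X in `|X|]/=.
- apply: le_trans (cnorm_re _).
  by rewrite !reimE /plane_form /= mulrN.
- apply: le_trans (cnorm_im _).
  by rewrite !reimE /plane_form /=.
Qed.

End ComplexPlane.

Lemma near_eq_differentiable (K : numFieldType) (V W : normedModType K)
    (f g : V -> W) x :
  {near x, f =1 g} -> differentiable f x -> differentiable g x.
Proof.
move=> fg df.
have fg0 : \forall v \near (0 : V), f (v + x) = g (v + x).
  by move: fg; rewrite (near_shift 0); apply: filterS => y; rewrite /= subr0.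
suff H : is_diff x g ('d f x) by exact: ex_diff.
apply: near_is_diff; first exact: diff_continuous.
move=> e e0; apply: filterS2 fg0 (diff_near df e0) => v <-.
by rewrite (nbhs_singleton fg).
Qed.

(** * Cauchy-Riemann equations and calculus of the del-bar operator *)

Section WirtingerDerivative.
Variable R : realType.
Implicit Types (z w : Cx R) (u v : R * R).

Lemma realify_comp (T : normedModType R) (h : Cx R -> T) (tau : Cx R -> Cx R) :
  realify (h \o tau) = realify h \o
    (fun u => (realify (@reC R \o tau) u, realify (@imC R \o tau) u)).
Proof.
by apply/funext => u; rewrite /realify /= -[X in _ = h X](planeK) /=; congr h; case: (tau _).
Qed.

Lemma rderive_lin (T : normedModType R) (h : Cx R -> T) z w :
  differentiable (realify h) (plane z) ->
  rderive w h z = reC w *: rderive 1 h z + imC w *: rderive 'i h z.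
Proof.
move=> dh; rewrite /rderive !deriveE // -!linearZ -linearD; congr ('d _ _ _).
rewrite reCi imCi reC1 imC1; congr pair; rewrite /= /GRing.scale /=; ring.
Qed.

(** The real differential of a holomorphic [tau] is multiplication by its complex derivative, so the
    real chain rule multiplies the direction [w] by that number. *)
Lemma rderive_comp (T : normedModType R) (h : Cx R -> T) (tau : Cx R -> Cx R) z w :
  derivable tau z 1 -> differentiable (realify h) (plane (tau z)) ->
  differentiable (realify (h \o tau)) (plane z) /\
  rderive w (h \o tau) z = rderive (derive1 tau z * w) h (tau z).
Proof.
move=> /derivable_is_diff[dre dim] dh.
have dp := is_diff_pair dre dim.
set F := fun u => _ in dp.
have Fz : F (plane z) = plane (tau z) by rewrite /F !realify_plane.
have dh' : is_diff (F (plane z)) (realify h) ('d (realify h) (plane (tau z))).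
  by rewrite Fz; exact: differentiableP.
have dc := is_diff_comp dp dh'.
rewrite /rderive realify_comp; split; first exact: ex_diff.
rewrite deriveE; last exact: ex_diff.
rewrite diff_val deriveE //=; congr ('d _ _ _).
by rewrite /plane_form /= !reimE; congr pair; ring.
Qed.

Lemma derivable_dbar (f : Cx R -> Cx R) z :
  derivable f z 1 -> cdifferentiable f z /\ dbar f z = 0.
Proof.
move=> /derivable_is_diff[dre dim]; split; first by split; exact: ex_diff.
rewrite /dbar /cderive /rderive !deriveE; try exact: ex_diff.
rewrite !diff_val /plane_form ?reC1 ?imC1 !reCi !imCi /=.
by apply: Cx_eqP; rewrite !reimE !reCi !imCi /=; ring.
Qed.

Definition mulr_by (d : Cx R) w : Cx R := w * d.

Lemma mulr_by_is_linear d : linear (mulr_by d).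
Proof. by move=> k a b; rewrite /mulr_by /GRing.scale /=; ring. Qed.

HB.instance Definition _ d :=
  GRing.isLinear.Build (Cx R) (Cx R) (Cx R) _ (mulr_by d) (mulr_by_is_linear d).

Lemma mulr_by_continuous d : continuous (mulr_by d).
Proof. exact: mulrr_continuous. Qed.

(** The Cauchy-Riemann equations turn the pair of real differentials into multiplication by [d], the
    derivative in the direction 1; the real expansions of the two parts then bound the complex
    remainder. *)
Lemma dbar_derivable (f : Cx R -> Cx R) z :
  cdifferentiable f z -> dbar f z = 0 -> derivable f z 1.
Proof.
move=> [dre dim] CR; apply/derivable1_diffP.
pose d : Cx R := cderive 1 f z.
suff H : is_diff z f (mulr_by d) by exact: ex_diff.
apply: near_is_diff; first exact: mulr_by_continuous.
move=> _ /gt0_toCx[e e0 ->].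
(* The errors of the real and of the imaginary part add up. *)
have e20 : 0 < e / 2 by rewrite divr_gt0.
have plane0 : plane 0 = 0 :> R * R by [].
have Hre := diff_near dre e20; have Him := diff_near dim e20.
rewrite -plane0 in Hre Him.
have {}Hre := near_plane Hre; have {}Him := near_plane Him.
apply: filterS2 Hre Him => w.
have dE h : differentiable (realify h) (plane z) ->
    'd (realify h) (plane z) (plane w) = reC w * rderive 1 h z + imC w * rderive 'i h z.
  by move=> dh; rewrite -(rderive_lin _ dh) /rderive deriveE.
rewrite !dE // !realify_shift !realify_plane /= planeK => Hre Him.
rewrite !cnormE -toCxM ler_toCx; apply: le_trans (cnorm_le _) _.
apply: le_trans (_ : e / 2 * `|plane w| + e / 2 * `|plane w| <= _); last first.
  by rewrite -mulrDl -splitr ler_wpM2l ?plane_cnorm // ltW.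
have [CR1 CR2] : rderive 'i (@imC R \o f) z = rderive 1 (@reC R \o f) z /\
    rderive 'i (@reC R \o f) z = - rderive 1 (@imC R \o f) z.
  have := congr1 (@reC R) CR; have := congr1 (@imC R) CR.
  rewrite /dbar /cderive !reimE !reCi !imCi /=.
  move: (rderive _ _ _) (rderive _ _ _) (rderive _ _ _) (rderive _ _ _).
  by move=> p q r s; lra.
apply: lerD; [apply: le_trans Hre|apply: le_trans Him];
  rewrite /mulr_by /d /cderive !reimE /= ?CR1 ?CR2 le_eqVlt; apply/orP; left;
  by apply/eqP; congr `|_|; ring.
Qed.

Lemma derive_mulB (V : normedModType R) (a b c d : V -> R) (u v : V) :
  derivable a u v -> derivable b u v -> derivable c u v -> derivable d u v ->
  'D_v (a * c - b * d) u =
  (a u * 'D_v c u + c u * 'D_v a u) - (b u * 'D_v d u + d u * 'D_v b u).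
Proof.
move=> da db dc dd.
rewrite (deriveB (derivableM da dc) (derivableM db dd)).
rewrite (deriveM da dc).
rewrite (deriveM db dd).
by [].
Qed.

Lemma derive_mulD (V : normedModType R) (a b c d : V -> R) (u v : V) :
  derivable a u v -> derivable b u v -> derivable c u v -> derivable d u v ->
  'D_v (a * d + b * c) u =
  (a u * 'D_v d u + d u * 'D_v a u) + (b u * 'D_v c u + c u * 'D_v b u).
Proof.
move=> da db dc dd.
rewrite (deriveD (derivableM da dd) (derivableM db dc)).
by rewrite (deriveM da dd) (deriveM db dc).
Qed.

Lemma leibniz_mkCx (a b c d a' b' c' d' : R) :
  mkCx ((a * c' + c * a') - (b * d' + d * b'))
       ((a * d' + d * a') + (b * c' + c * b')) =
  mkCx a b * mkCx c' d' + mkCx c d * mkCx a' b'.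
Proof. by apply: Cx_eqP; rewrite !reimE /=; ring. Qed.

Lemma cderiveM f g z (w : Cx R) : cdifferentiable f z -> cdifferentiable g z ->
  cdifferentiable (fun x => f x * g x) z /\
  cderive w (fun x => f x * g x) z = f z * cderive w g z + g z * cderive w f z.
Proof.
move=> [fr fi] [gr gi].
set a := realify _ in fr; set b := realify _ in fi.
set c := realify _ in gr; set d := realify _ in gi.
have E1 : realify (@reC R \o (fun x => f x * g x)) = a * c - b * d.
  by apply/funext => u; rewrite /realify /= reCM.
have E2 : realify (@imC R \o (fun x => f x * g x)) = a * d + b * c.
  by apply/funext => u; rewrite /realify /= imCM.
split.
  by split; rewrite ?E1 ?E2; [apply: differentiableB|apply: differentiableD];
    apply: differentiableM.
rewrite /cderive /rderive -!/(plane _) E1 E2 -/a -/b -/c -/d.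
have -> : f z = mkCx (a (plane z)) (b (plane z)).
  by rewrite /a /b !realify_plane /=; case: (f z).
have -> : g z = mkCx (c (plane z)) (d (plane z)).
  by rewrite /c /d !realify_plane /=; case: (g z).
rewrite derive_mulB ?derive_mulD //; try exact: diff_derivable.
exact: leibniz_mkCx.
Qed.

Lemma cderiveD f g z (w : Cx R) : cdifferentiable f z -> cdifferentiable g z ->
  cdifferentiable (fun x => f x + g x) z /\
  cderive w (fun x => f x + g x) z = cderive w f z + cderive w g z.
Proof.
move=> [fr fi] [gr gi].
set a := realify _ in fr; set b := realify _ in fi.
set c := realify _ in gr; set d := realify _ in gi.
have E1 : realify (@reC R \o (fun x => f x + g x)) = a + c.
  by apply/funext => u; rewrite /realify /= reCD.
have E2 : realify (@imC R \o (fun x => f x + g x)) = b + d.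
  by apply/funext => u; rewrite /realify /= imCD.
split; first by split; rewrite ?E1 ?E2; apply: differentiableD.
rewrite /cderive /rderive -!/(plane _) E1 E2 -/a -/b -/c -/d.
by rewrite !deriveD; try exact: diff_derivable.
Qed.

Lemma cderive_cst k z (w : Cx R) :
  cdifferentiable (fun=> k) z /\ cderive w (fun=> k) z = 0.
Proof.
have E1 : realify (@reC R \o (fun=> k)) = cst (reC k) by [].
have E2 : realify (@imC R \o (fun=> k)) = cst (imC k) by [].
split; first by split; [rewrite E1|rewrite E2]; exact: differentiable_cst.
by rewrite /cderive /rderive E1 E2 !derive_cst.
Qed.

Lemma dbarM f g z : cdifferentiable f z -> cdifferentiable g z ->
  dbar (fun x => f x * g x) z = f z * dbar g z + g z * dbar f z.
Proof.
move=> df dg; rewrite /dbar !(cderiveM _ df dg).2.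
move: (f z) (g z) (cderive 1 f z) (cderive 1 g z) (cderive 'i f z) (cderive 'i g z).
by move=> a b c d p q; ring.
Qed.

Lemma dbarD f g z : cdifferentiable f z -> cdifferentiable g z ->
  dbar (fun x => f x + g x) z = dbar f z + dbar g z.
Proof.
move=> df dg; rewrite /dbar !(cderiveD _ df dg).2.
move: (cderive 1 f z) (cderive 1 g z) (cderive 'i f z) (cderive 'i g z).
by move=> a b c d; ring.
Qed.

Lemma dbar_cst k z : dbar (fun=> k) z = 0.
Proof. by rewrite /dbar !(cderive_cst k z _).2 mulr0 addr0. Qed.

Lemma near_eq_dbar f g z : {near z, f =1 g} -> dbar f z = dbar g z.
Proof.
move=> fg; rewrite /dbar /cderive /rderive.
have H : \forall u \near plane z, f (unplane u) = g (unplane u).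
  by apply: (@near_unplane _ (fun x => f x = g x)); rewrite planeK.
have Hr v : 'D_v (realify (@reC R \o f)) (plane z) = 'D_v (realify (@reC R \o g)) (plane z).
  by apply: near_eq_derive; apply: filterS H => u; rewrite /realify /= /unplane => ->.
have Hi v : 'D_v (realify (@imC R \o f)) (plane z) = 'D_v (realify (@imC R \o g)) (plane z).
  by apply: near_eq_derive; apply: filterS H => u; rewrite /realify /= /unplane => ->.
by rewrite -!/(plane _) !Hr !Hi.
Qed.

End WirtingerDerivative.

(** * Conformal frames and stereographic projection *)

(** The vector x - i y, with the sign of the Weierstrass form: the coordinate derivatives of an
    immersion give the coefficient of [omega]. *)
Definition null_of (R : realType) n (x y : 'rV[R]_n) : 'rV[Cx R]_n :=
  \row_j mkCx (x 0 j) (- y 0 j).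

Section Frames.
Variable R : realType.
Implicit Types x y n : 'rV[R]_3.

Lemma sum3E (V : nmodType) (F : 'I_3 -> V) :
  \sum_i F i = F (inord 0) + F (inord 1) + F (inord 2).
Proof.
rewrite !big_ord_recl big_ord0 addr0 addrA.
by congr (_ + _ + _); congr F; apply: val_inj; rewrite /= inordK.
Qed.

Definition cross3 x y : 'rV[R]_3 :=
  \row_(j < 3) nth 0 [:: x 0 (inord 1) * y 0 (inord 2) - x 0 (inord 2) * y 0 (inord 1);
                         x 0 (inord 2) * y 0 (inord 0) - x 0 (inord 0) * y 0 (inord 2);
                         x 0 (inord 0) * y 0 (inord 1) - x 0 (inord 1) * y 0 (inord 0)] j.

Lemma dot3E x y : dot3 x y = x 0 (inord 0) * y 0 (inord 0)
  + x 0 (inord 1) * y 0 (inord 1) + x 0 (inord 2) * y 0 (inord 2).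
Proof. exact: sum3E. Qed.

Lemma det3E x y n : det3 x y n = dot3 (cross3 x y) n.
Proof.
rewrite dot3E !mxE !inordK //= /det3 (expand_det_row _ (inord 2)) sum3E.
rewrite /cofactor !(expand_det_row _ ord0) !big_ord_recl !big_ord0 /cofactor.
rewrite !det_mx11 !mxE /=.
(* Brings the column indices of the minors, which appear as nested [lift]s, to the form
   [inord m]. *)
have L k (i : 'I_2) m : (k < 3)%N -> (m < 3)%N -> bump k i = m ->
    lift (inord k) i = inord m :> 'I_3.
  by move=> k3 m3 E; rewrite -E in m3 *; apply: val_inj; rewrite /= !inordK //.
rewrite ?(L 0%N (lift (lift ord0 ord0) 0) 1%N) // ?(L 0%N (lift ord0 0) 2%N) //.
rewrite ?(L 0%N (lift ord0 ord0) 2%N) // ?(L 0%N ord0 1%N) //.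
rewrite ?(L 1%N (lift (lift ord0 ord0) 0) 0%N) // ?(L 1%N (lift ord0 0) 2%N) //.
rewrite ?(L 1%N (lift ord0 ord0) 2%N) // ?(L 1%N ord0 0%N) //.
rewrite ?(L 2%N (lift (lift ord0 ord0) 0) 0%N) // ?(L 2%N (lift ord0 0) 1%N) //.
rewrite ?(L 2%N (lift ord0 ord0) 1%N) // ?(L 2%N ord0 0%N) //.
by rewrite !inordK //= /bump /= !expr0 ?expr1 ?expr2; ring.
Qed.

(** Gathers the pointwise geometry, so that the identities below are pure linear algebra: [x] and
    [y] will be the coordinate derivatives of [phi] in a chart, [l] the conformal factor and [n] the
    Gauss map. *)
Record conformal_frame (l : R) x y n : Prop := ConformalFrame {
  frame_pos : 0 < l;
  frame_x : dot3 x x = l;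
  frame_y : dot3 y y = l;
  frame_xy : dot3 x y = 0;
  frame_n : dot3 n n = 1;
  frame_nx : dot3 n x = 0;
  frame_ny : dot3 n y = 0;
  frame_det : 0 < det3 x y n }.

Lemma row3P (u v : 'rV[R]_3) : u 0 (inord 0) = v 0 (inord 0) ->
  u 0 (inord 1) = v 0 (inord 1) -> u 0 (inord 2) = v 0 (inord 2) -> u = v.
Proof.
move=> h0 h1 h2; apply/rowP => j; rewrite -(inord_val j).
by case: j => -[|[|[|//]]].
Qed.

Lemma cross3E x y :
  (cross3 x y 0 (inord 0) =
    x 0 (inord 1) * y 0 (inord 2) - x 0 (inord 2) * y 0 (inord 1)) *
  (cross3 x y 0 (inord 1) =
    x 0 (inord 2) * y 0 (inord 0) - x 0 (inord 0) * y 0 (inord 2)) *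
  (cross3 x y 0 (inord 2) =
    x 0 (inord 0) * y 0 (inord 1) - x 0 (inord 1) * y 0 (inord 0)).
Proof. by rewrite /cross3 !mxE !inordK. Qed.

(** The two combinations are the images of the tangent vector with coordinate [a + i b] and of its
    product by [i]. Thus the orientation condition on one nonzero tangent vector implies it on
    all. *)
Lemma det3_rotate a b x y n :
  det3 (a *: x + b *: y) (- b *: x + a *: y) n = (a ^+ 2 + b ^+ 2) * det3 x y n.
Proof. by rewrite !det3E !dot3E !cross3E !mxE; ring. Qed.

Lemma dot3DZ a b x y n :
  dot3 n (a *: x + b *: y) = a * dot3 n x + b * dot3 n y.
Proof. by rewrite !dot3E !mxE; ring. Qed.

Lemma dot3Dl x y n : dot3 (x + y) n = dot3 x n + dot3 y n.
Proof. by rewrite !dot3E !mxE; ring. Qed.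

Lemma null_dot x y (u : 'rV[R]_3) : \sum_i null_of x y 0 i * toCx (u 0 i) =
  mkCx (dot3 u x) (- dot3 u y).
Proof.
by rewrite sum3E !mxE; apply: Cx_eqP; rewrite !reimE !dot3E /=; ring.
Qed.

Lemma triple_cross x y n : cross3 (cross3 x y) n = dot3 n x *: y - dot3 n y *: x.
Proof. by apply: row3P; rewrite !(cross3E, mxE, dot3E); ring. Qed.

Lemma cross3_dot x y : dot3 (cross3 x y) (cross3 x y) =
  dot3 x x * dot3 y y - dot3 x y ^+ 2.
Proof. by rewrite !dot3E !cross3E; ring. Qed.

(** The triple product shows that [c] has zero cross product with [n], hence [c = k *: n]. The
    orientation gives [k > 0], and Lagrange's identity gives [k ^+ 2 = l ^+ 2]. *)
Lemma cross3_frame l x y n : conformal_frame l x y n -> cross3 x y = l *: n.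
Proof.
move=> [l0 xx yy xy nn nx ny dt]; set c := cross3 x y.
have cn : cross3 c n = 0 by rewrite triple_cross nx ny !scale0r subrr.
pose k := dot3 c n.
have ck : c = k *: n.
  have : dot3 n n *: c - dot3 n c *: n = cross3 (cross3 n c) n.
    by rewrite triple_cross.
  have -> : cross3 n c = - cross3 c n.
    by apply: row3P; rewrite !(cross3E, mxE); ring.
  rewrite cn nn scale1r oppr0.
  have -> : cross3 0 n = 0 by apply: row3P; rewrite !(cross3E, mxE); ring.
  have -> : dot3 n c = k by rewrite /k !dot3E; ring.
  by move/eqP; rewrite subr_eq0 => /eqP.
have k0 : 0 < k by rewrite /k -det3E.
have k2 : k ^+ 2 = l ^+ 2.
  have := cross3_dot x y; rewrite -/c xx yy xy expr0n subr0 -expr2 => <-.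
  rewrite [in RHS]ck -[k ^+ 2]mulr1 -nn !dot3E !mxE; ring.
have -> // : l = k.
by apply/eqP; rewrite eq_sym -(@eqrXn2 _ 2) ?k2 // ltW.
Qed.

(** After multiplication by [l], the normal becomes [cross3 x y] and the product becomes a triple
    product. *)
Lemma frame_cross_yn l x y n : conformal_frame l x y n -> cross3 y n = x.
Proof.
move=> fr; have [l0 xx yy xy nn nx ny dt] := fr.
have l_neq0 : l != 0 by rewrite lt0r_neq0.
apply: (scalerI l_neq0).
have -> : l *: cross3 y n = - cross3 (l *: n) y.
  by apply: row3P; rewrite !(cross3E, mxE); ring.
rewrite -(cross3_frame fr) triple_cross yy.
have -> : dot3 y x = 0 by rewrite -xy !dot3E; ring.
by rewrite scale0r sub0r opprK.
Qed.

Lemma frame_cross_nx l x y n : conformal_frame l x y n -> cross3 n x = y.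
Proof.
move=> fr; have [l0 xx yy xy nn nx ny dt] := fr.
have l_neq0 : l != 0 by rewrite lt0r_neq0.
apply: (scalerI l_neq0).
have -> : l *: cross3 n x = cross3 (l *: n) x.
  by apply: row3P; rewrite !(cross3E, mxE); ring.
by rewrite -(cross3_frame fr) triple_cross xx xy scale0r subr0.
Qed.

Lemma frame_exists l x y : 0 < l -> dot3 x x = l -> dot3 y y = l ->
  dot3 x y = 0 -> conformal_frame l x y (l^-1 *: cross3 x y).
Proof.
move=> l0 xx yy xy; have l_neq0 : l != 0 by rewrite lt0r_neq0.
have dZl a (u v : 'rV[R]_3) : dot3 (a *: u) v = a * dot3 u v.
  by rewrite !dot3E !mxE; ring.
have dC (u v : 'rV[R]_3) : dot3 u v = dot3 v u by rewrite !dot3E; ring.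
split => //.
- by rewrite dZl dC dZl cross3_dot xx yy xy; field.
- by rewrite dZl !(dot3E, cross3E); ring.
- by rewrite dZl !(dot3E, cross3E); ring.
- rewrite det3E dC dZl cross3_dot xx yy xy expr0n subr0 mulrA mulVf // mul1r.
  exact: l0.
Qed.

(** Orthogonality to [x] and [y] makes [u] parallel to their cross product, that is to [n]; the last
    condition then kills it. *)
Lemma frame_span l x y n u : conformal_frame l x y n ->
  dot3 u x = 0 -> dot3 u y = 0 -> dot3 u n = 0 -> u = 0.
Proof.
move=> fr ux uy un; have [l0 xx yy xy nn nx ny dt] := fr.
have l_neq0 : l != 0 by rewrite lt0r_neq0.
have cun : cross3 u n = 0.
  apply: (scalerI l_neq0).
  have -> : l *: cross3 u n = - cross3 (l *: n) u.
    by apply: row3P; rewrite !(cross3E, mxE); ring.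
  by rewrite -(cross3_frame fr) triple_cross ux uy !scale0r subrr oppr0 scaler0.
have := triple_cross n u n; rewrite nn.
have -> : cross3 n u = - cross3 u n by apply: row3P; rewrite !(cross3E, mxE); ring.
have -> : dot3 n u = 0 by rewrite -un !dot3E; ring.
rewrite cun oppr0 scale1r scale0r subr0 => <-.
by apply: row3P; rewrite !(cross3E, mxE); ring.
Qed.

(** In conformal coordinates E = G = [l] and F = 0, so the quotient is the normal part of [a + b]
    divided by [2 * l]. *)
Lemma frame_curvature_eq0 l x y n (a b : 'rV[R]_3) (f : R) :
  conformal_frame l x y n ->
  (dot3 a n * dot3 y y - 2 * f * dot3 x y + dot3 b n * dot3 x x)
    / (2 * (dot3 x x * dot3 y y - dot3 x y ^+ 2)) = 0 <-> dot3 (a + b) n = 0.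
Proof.
move=> [l0 xx yy xy _ _ _ _]; rewrite xx yy xy dot3Dl.
move: (dot3 a n) (dot3 b n) => s t.
have -> : (s * l - 2 * f * 0 + t * l) / (2 * (l * l - 0 ^+ 2)) = (s + t) / (2 * l).
  by field; exact: lt0r_neq0.
split=> [/eqP|->]; last by rewrite mul0r.
by rewrite mulf_eq0 invr_eq0 mulf_eq0 pnatr_eq0 (gt_eqF l0) /= !orbF => /eqP.
Qed.

Lemma null_of_neq0 l x y n : conformal_frame l x y n -> null_of x y != 0.
Proof.
move=> [l0 xx _ _ _ _ _ _]; apply: contraTneq l0 => f0.
have x0 j : x 0 j = 0.
  by have := congr1 (fun w : 'rV[Cx R]_3 => reC (w 0 j)) f0; rewrite !mxE.
by rewrite -xx dot3E !x0 !mul0r !addr0 ltxx.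
Qed.

Lemma frame_null_dot l x y n : conformal_frame l x y n ->
  \sum_i null_of x y 0 i * toCx (n 0 i) = 0.
Proof. by move=> fr; rewrite null_dot (frame_nx fr) (frame_ny fr) oppr0. Qed.

Lemma null_of_quadric l x y n : conformal_frame l x y n ->
  \sum_i null_of x y 0 i ^+ 2 = 0.
Proof.
move=> [l0 xx yy xy _ _ _ _]; rewrite sum3E !mxE.
move: xx yy xy; rewrite !dot3E => xx yy xy.
apply: Cx_eqP; rewrite !expr2 !reimE /=; first by rewrite -[RHS](subrr l) -{1}xx -yy; ring.
by rewrite -[RHS](mulr0 (- 2)) -xy; ring.
Qed.

End Frames.

(** * Spinor coordinates on the conic *)

Section Stereographic.
Variable R : realType.
Implicit Types f : 'rV[Cx R]_3.

(** On the parametrization f = (z_0^2 - z_1^2, i (z_0^2 + z_1^2), 2 z_0 z_1) one finds [spinor0] = 2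
    z_0^2 and [spinor1] = 2 z_1^2, so [z_0 : z_1] is both [spinor0 : f_2] and [f_2 : spinor1]. *)
Definition spinor0 f : Cx R := f 0 (inord 0) - 'i * f 0 (inord 1).
Definition spinor1 f : Cx R := - f 0 (inord 0) - 'i * f 0 (inord 1).

Lemma Cxi2 : 'i * 'i = -1 :> Cx R. Proof. by rewrite -expr2 sqrCi. Qed.

Lemma spinorM f : \sum_i f 0 i ^+ 2 = 0 ->
  spinor0 f * spinor1 f = f 0 (inord 2) ^+ 2.
Proof.
rewrite sum3E /spinor0 /spinor1 => H.
set a := f 0 _ in H *; set b := f 0 _ in H *; set c := f 0 _ in H *.
rewrite -[RHS]subr0 -H.
have -> : (a - 'i * b) * (- a - 'i * b) = - a ^+ 2 + ('i * 'i) * b ^+ 2 by ring.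
by rewrite Cxi2; ring.
Qed.

Lemma spinor_eq0 f : \sum_i f 0 i ^+ 2 = 0 ->
  spinor0 f = 0 -> spinor1 f = 0 -> f = 0.
Proof.
move=> H s0 s1; have := spinorM H; rewrite s0 mul0r => /esym/eqP.
rewrite expf_eq0 /= => /eqP f2.
have f0 : f 0 (inord 0) = 0.
  have : spinor0 f - spinor1 f = 2 * f 0 (inord 0) by rewrite /spinor0 /spinor1; ring.
  by rewrite s0 s1 subrr => /esym/eqP; rewrite mulf_eq0 pnatr_eq0 /= => /eqP.
have f1 : f 0 (inord 1) = 0.
  have : spinor0 f + spinor1 f = - 2 * 'i * f 0 (inord 1) by rewrite /spinor0 /spinor1; ring.
  rewrite s0 s1 addr0 => /esym/eqP; rewrite !mulf_eq0 oppr_eq0 pnatr_eq0 /=.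
  by rewrite (negPf (neq0Ci _)) /= => /eqP.
apply/rowP => j; rewrite mxE -(inord_val j).
by case: j => -[|[|[|//]]].
Qed.

Definition row2 (a b : Cx R) : 'rV[Cx R]_2 := \row_(j < 2) nth 0 [:: a; b] j.

Lemma row2Z k a b : k *: row2 a b = row2 (k * a) (k * b).
Proof. by apply/rowP => -[[|[|//]] j2]; rewrite !mxE. Qed.

(** The cross-multiplied equality of [1 - n_2 : n_0 + i n_1] with [spinor0 : f_2], valid at the pole
    too. It is linear in the relations n . x = n . y = 0 and the last components of x = y × n and y
    = n × x. *)
Lemma stereographic_spinor0 l (x y n : 'rV[R]_3) : conformal_frame l x y n ->
  toCx (1 - n 0 (inord 2)) * null_of x y 0 (inord 2) =
  mkCx (n 0 (inord 0)) (n 0 (inord 1)) * spinor0 (null_of x y).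
Proof.
move=> fr; have [l0 xx yy xy nn nx ny dt] := fr.
have xE := frame_cross_yn fr; have yE := frame_cross_nx fr.
have x2 := congr1 (fun u : 'rV[R]_3 => u 0 (inord 2)) xE.
have y2 := congr1 (fun u : 'rV[R]_3 => u 0 (inord 2)) yE.
rewrite /= !cross3E in x2 y2; rewrite !dot3E in nx ny.
rewrite /spinor0 !mxE.
apply: Cx_eqP; rewrite !reimE !reCi !imCi /=; move: nx ny x2 y2.
  by move: (x 0 _) (x 0 _) (x 0 _) (y 0 _) (y 0 _) (y 0 _) (n 0 _) (n 0 _) (n 0 _) => *; lra.
by move: (x 0 _) (x 0 _) (x 0 _) (y 0 _) (y 0 _) (y 0 _) (n 0 _) (n 0 _) (n 0 _) => *; lra.
Qed.

End Stereographic.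

(** * Charts and the Weierstrass form *)

Section LocalFormulas.
Variable R : realType.
Implicit Types (v w z : Cx R) (U : set (Cx R)).

Lemma near_eq_rderive (W : normedModType R) (h1 h2 : Cx R -> W) v z :
  {near z, h1 =1 h2} -> rderive v h1 z = rderive v h2 z.
Proof.
move=> h12; apply: near_eq_derive.
have : \forall u \near plane z, h1 (unplane u) = h2 (unplane u).
  by apply: (@near_unplane _ (fun x => h1 x = h2 x)); rewrite planeK.
by apply: filterS => u /=.
Qed.

Lemma rderive_coord n (h : Cx R -> 'rV[R]_n) v z j :
  differentiable (realify h) (plane z) ->
  rderive v h z 0 j = rderive v (fun x => h x 0 j) z.
Proof.
by move=> dh; rewrite /rderive derive_mx ?mxE //; exact: diff_derivable.
Qed.

Lemma differentiable_realify_coord n (h : Cx R -> 'rV[R]_n) z j :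
  differentiable (realify h) (plane z) ->
  differentiable (realify (fun x => h x 0 j)) (plane z).
Proof.
by move=> dh; exact: differentiable_comp dh (differentiable_coord _ 0 j).
Qed.

Lemma smooth_on0 (W : normedModType R) U (h : Cx R -> W) z : smooth_on U h -> U z ->
  differentiable (realify h) (plane z).
Proof. by move=> sh Uz; exact: (sh [::] z Uz). Qed.

Lemma smooth_on_rderive (W : normedModType R) U (h : Cx R -> W) v :
  smooth_on U h -> smooth_on U (rderive v h).
Proof.
move=> sh s z Uz; have := sh (rcons s v) z Uz.
by rewrite /iter_rderive -cats1 foldr_cat.
Qed.

(** [derive_sym] concerns scalar functions, so each entry is treated apart; entries and first
    derivatives must be exchanged on a whole neighbourhood before differentiating again. *)
Lemma rderive_sym n U (h : Cx R -> 'rV[R]_n) v w z :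
  open U -> smooth_on U h -> U z ->
  rderive w (rderive v h) z = rderive v (rderive w h) z.
Proof.
move=> oU sh Uz; apply/rowP => j.
pose g := fun x => h x 0 j.
have nU : \forall u \near plane z, U (unplane u).
  by apply: near_unplane; rewrite planeK; exact: open_nbhs_nbhs.
have dgE x : {near plane z, realify (fun y => rderive x h y 0 j) =1
    'D_(plane x) (realify g)}.
  apply: filterS nU => u Uu; rewrite /realify -/(unplane u) rderive_coord.
    by rewrite /rderive -/(plane (unplane u)) unplaneK.
  exact: smooth_on0 Uu.
have ddg x : differentiable ('D_(plane x) (realify g)) (plane z).
  apply: near_eq_differentiable (dgE x) _; apply: differentiable_realify_coord.
  exact: smooth_on0 (smooth_on_rderive _ sh) Uz.
have E x y : rderive y (rderive x h) z 0 j =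
    'D_(plane y) ('D_(plane x) (realify g)) (plane z).
  rewrite rderive_coord; last exact: smooth_on0 (smooth_on_rderive _ sh) Uz.
  exact: near_eq_derive (dgE x).
have dgn : \forall u \near plane z, differentiable (realify g) u.
  apply: filterS nU => u Uu; rewrite -(unplaneK u).
  by apply: differentiable_realify_coord; exact: smooth_on0 Uu.
exact: etrans (E v w) (etrans (derive_sym dgn (ddg v) (ddg w)) (esym (E w v))).
Qed.

(* Twice the del-derivative of [h]; for [h] the immersion read in a chart, the
   coefficient of its Weierstrass form [omega]. *)
Definition weier n (h : Cx R -> 'rV[R]_n) z : 'rV[Cx R]_n :=
  null_of (rderive 1 h z) (rderive 'i h z).

Lemma reC_weier n (h : Cx R -> 'rV[R]_n) j :
  @reC R \o (fun x => weier h x 0 j) = fun x => rderive 1 h x 0 j.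
Proof. by apply/funext => x; rewrite /= /weier /null_of mxE. Qed.

Lemma imC_weier n (h : Cx R -> 'rV[R]_n) j :
  @imC R \o (fun x => weier h x 0 j) = - (fun x => rderive 'i h x 0 j).
Proof. by apply/funext => x; rewrite /= /weier /null_of mxE. Qed.

Lemma weier_cdifferentiable n U (h : Cx R -> 'rV[R]_n) z j :
  smooth_on U h -> U z -> cdifferentiable (fun x => weier h x 0 j) z.
Proof.
move=> sh Uz.
have D v : differentiable (realify (fun x => rderive v h x 0 j)) (plane z).
  by apply: differentiable_realify_coord; exact: smooth_on0 (smooth_on_rderive _ sh) Uz.
split; first by rewrite reC_weier; exact: D.
by rewrite imC_weier; exact: differentiableN (D 'i).
Qed.

Lemma dbar_mkCx n (A B B' C : 'rV[R]_n) j : B' = B ->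
  mkCx (A 0 j) (- B 0 j) + 'i * mkCx (B' 0 j) (- C 0 j) = toCx ((A + C) 0 j).
Proof.
by move=> ->; rewrite mxE; apply: Cx_eqP; rewrite !reimE !reCi !imCi /=; ring.
Qed.

Lemma dbar_weier n U (h : Cx R -> 'rV[R]_n) z j :
  open U -> smooth_on U h -> U z ->
  dbar (fun x => weier h x 0 j) z = toCx (laplacian h z 0 j).
Proof.
move=> oU sh Uz.
have D v : differentiable (realify (rderive v h)) (plane z).
  exact: smooth_on0 (smooth_on_rderive _ sh) Uz.
have Dj v : differentiable (realify (fun x => rderive v h x 0 j)) (plane z).
  exact: differentiable_realify_coord.
have N v : rderive v (- (fun x => rderive 'i h x 0 j)) z =
    - rderive v (rderive 'i h) z 0 j.
  by rewrite rderive_coord // -deriveN //; exact: diff_derivable.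
have E v w : rderive v (fun x => rderive w h x 0 j) z = rderive v (rderive w h) z 0 j.
  by rewrite -rderive_coord.
rewrite /dbar /cderive reC_weier imC_weier (N 1) (N 'i) (E 1 1) (E 'i 1).
exact: dbar_mkCx (rderive_sym 1 'i oU sh Uz).
Qed.

End LocalFormulas.

Section Charts.
Variables (R : realType) (M : riemann_surface R).
Implicit Types (c d : chart M (Cx R)) (p : M).

Lemma near_cdom c p : rs_atlas c -> cdom c p ->
  \forall z \near cmap c p, (cmap c @` cdom c) z.
Proof.
move=> /rs_chart[_ oc _ _ _] cp; apply: open_nbhs_nbhs; split => //.
Qed.

Lemma cinvK c p : rs_atlas c -> cdom c p -> cinv c (cmap c p) = p.
Proof. by move=> /rs_chart[_ _ + _ _]; apply. Qed.

Lemma near_cinv c p (P : set M) : rs_atlas c -> cdom c p ->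
  (\forall q \near p, P q) -> \forall z \near cmap c p, P (cinv c z).
Proof.
move=> Ac cp nP; have /rs_chart[_ _ _ _ /(_ _ cp)] := Ac; apply.
by rewrite cinvK.
Qed.

Lemma open_cdom c p : rs_atlas c -> cdom c p -> \forall q \near p, cdom c q.
Proof. by move=> /rs_chart[oc _ _ _ _] cp; apply: open_nbhs_nbhs. Qed.

Lemma chart_at_atlas p : rs_atlas (chart_at p).
Proof. by rewrite /chart_at; case: cid => c []. Qed.

Lemma chart_at_dom p : cdom (chart_at p) p.
Proof. by rewrite /chart_at; case: cid => c []. Qed.

Lemma rderive_chart (W : normedModType R) (phi : M -> W) c d p v :
  rs_atlas c -> rs_atlas d -> cdom c p -> cdom d p ->
  differentiable (realify (phi \o cinv c)) (plane (cmap c p)) ->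
  rderive v (phi \o cinv d) (cmap d p) =
  rderive (derive1 (cmap c \o cinv d) (cmap d p) * v) (phi \o cinv c) (cmap c p).
Proof.
move=> Ac Ad cp dp dphi.
have tau := rs_transition Ad Ac dp cp.
have tauE : (cmap c \o cinv d) (cmap d p) = cmap c p by rewrite /= cinvK.
rewrite -tauE in dphi *.
rewrite -(rderive_comp v tau dphi).2; apply: near_eq_rderive.
apply: filterS (near_cinv Ad dp (open_cdom Ac cp)) => z cz /=.
by rewrite cinvK.
Qed.

(** * Conformal immersions read in an arbitrary chart *)

Section Conformal.
Variables (phi : M -> 'rV[R]_3) (hphi : conformal_immersion phi).

Lemma phi_differentiable c z : rs_atlas c -> (cmap c @` cdom c) z ->
  differentiable (realify (phi \o cinv c)) (plane z).
Proof. by move=> Ac cz; exact: smooth_on0 (hphi.1 c Ac) cz. Qed.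

(** [of_chart c p * v] is the tangent vector with coordinate [v] in [c]; the equality is the chain
    rule for the passage from [c] to the preferred chart. *)
Lemma dmap_chart c p v : rs_atlas c -> cdom c p ->
  dmap phi p (of_chart c p * v) = rderive v (phi \o cinv c) (cmap c p).
Proof.
move=> Ac cp; rewrite (@rderive_chart _ phi (chart_at p) c p v) //.
- exact: chart_at_atlas.
- exact: chart_at_dom.
- apply: phi_differentiable; first exact: chart_at_atlas.
  by exists p => //; exact: chart_at_dom.
Qed.

(** Both sides have the same image under the injective [dmap phi p], by the chain rule for [phi]. *)
Lemma to_of_chart c p : rs_atlas c -> cdom c p -> of_chart c p * to_chart c p = 1.
Proof.
move=> Ac cp; have [_ /(_ p)[inj _]] := hphi; apply: inj.
rewrite (dmap_chart _ Ac cp) -[to_chart c p]mulr1; apply/esym.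
apply: (rderive_chart 1 Ac (chart_at_atlas p) cp (chart_at_dom p)).
by apply: phi_differentiable => //; exists p.
Qed.

Lemma of_chart_neq0 c p : rs_atlas c -> cdom c p -> of_chart c p != 0.
Proof.
move=> Ac cp; apply: contra_eq_neq (to_of_chart Ac cp) => ->.
by rewrite mul0r eq_sym oner_eq0.
Qed.

Lemma conformal_chart c p : rs_atlas c -> cdom c p ->
  let h := phi \o cinv c in let z := cmap c p in
  exists2 l : R, 0 < l & [/\ dot3 (rderive 1 h z) (rderive 1 h z) = l,
    dot3 (rderive 'i h z) (rderive 'i h z) = l &
    dot3 (rderive 1 h z) (rderive 'i h z) = 0].
Proof.
move=> Ac cp h z; have [_ /(_ p)[_ [l l0 H]]] := hphi.
have a0 := of_chart_neq0 Ac cp.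
have {}H v w : dot3 (rderive v h z) (rderive w h z) =
    l * reC ((of_chart c p * v) * (of_chart c p * w)^*).
  by rewrite /h /z -!dmap_chart.
move: (of_chart c p) a0 H => a a0 H.
have conjE (x y : Cx R) : reC (x * y^*) = reC x * reC y + imC x * imC y.
  by case: x y => [x1 x2] [y1 y2]; rewrite reCM /= mulrN opprK.
exists (l * (reC a ^+ 2 + imC a ^+ 2)); last first.
  split; apply: etrans (H _ _) _; rewrite conjE ?mulr1.
  - by ring.
  - by rewrite !reCM !imCM !reCi !imCi; ring.
  - by rewrite !reCM !imCM !reCi !imCi; ring.
rewrite mulr_gt0 // lt0r addr_ge0 ?sqr_ge0 // andbT.
apply: contra_neq a0 => /eqP; rewrite paddr_eq0 ?sqr_ge0 // !sqrf_eq0.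
by move=> /andP[/eqP ra /eqP ia]; apply: Cx_eqP.
Qed.

Lemma weierstrass_chart c p w : rs_atlas c -> cdom c p ->
  weierstrass phi p (of_chart c p * w) = w *: weier (phi \o cinv c) (cmap c p).
Proof.
move=> Ac cp; rewrite /weierstrass mulrCA !dmap_chart //.
have dh : differentiable (realify (phi \o cinv c)) (plane (cmap c p)).
  by apply: phi_differentiable => //; exists p.
rewrite (rderive_lin w dh) (rderive_lin ('i * w) dh) /weier /null_of.
move: (rderive 1 _ _) (rderive 'i _ _) => a b.
by apply/rowP => j; rewrite !mxE; apply: Cx_eqP; rewrite !reimE !reCi !imCi /=; ring.
Qed.

Lemma eta_chart c p : rs_atlas c -> cdom c p ->
  eta_map phi p = proj_point (weier (phi \o cinv c) (cmap c p)).
Proof.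
move=> Ac cp; apply/seteqP; split => [_ [v _ <-]|_ [v _ <-]].
  have vE : of_chart c p * (to_chart c p * v) = v.
    by rewrite mulrA (to_of_chart Ac cp) mul1r.
  have wE := weierstrass_chart (to_chart c p * v) Ac cp.
  have {wE} wE := etrans (congr1 (weierstrass phi p) (esym vE)) wE.
  by exists (to_chart c p * v); [|exact: esym wE].
by exists (of_chart c p * v); [|exact: weierstrass_chart].
Qed.

End Conformal.
End Charts.

(** * Projective space *)

Section Projective.
Variables (R : realType) (n : nat).
Implicit Types (w : 'rV[Cx R]_n.+2) (k : 'I_n.+2).

Lemma proj_point_self w : proj_point w w.
Proof. by exists 1 => //; rewrite scale1r. Qed.

Lemma proj_pointZ a w : a != 0 -> proj_point (a *: w) = proj_point w.
Proof.
move=> a0; apply/seteqP; split => [_ [b _ <-]|_ [b _ <-]].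
  by exists (b * a) => //; rewrite scalerA.
by exists (b / a) => //; rewrite scalerA divfK.
Qed.

Lemma affine_chart_dom k w : cdom (affine_chart R k) (proj_point w) <-> w 0 k != 0.
Proof.
split=> [[w' /= w'k ww']|wk]; last by exists w.
have [a _ aw] : proj_point w w' by rewrite -ww'; exact: proj_point_self.
by apply: contra_neq w'k => wk0; rewrite -aw mxE wk0 mulr0.
Qed.

Lemma affine_chart_map k w : w 0 k != 0 ->
  cmap (affine_chart R k) (proj_point w) = col' k ((w 0 k)^-1 *: w).
Proof.
move=> wk; rewrite /=; congr (col' k _); apply: xget_unique.
  by split; [exists (w 0 k)^-1|rewrite mxE mulVf].
move=> _ [[a _ <-]]; rewrite mxE => awk.
by congr (_ *: w); rewrite -[RHS]mul1r -awk mulfK.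
Qed.

Lemma ex_affine_chart w : w != 0 -> exists k, w 0 k != 0.
Proof. by move=> /rV0Pn. Qed.

Lemma differentiable_row (K : numFieldType) (V : normedModType K) m
    (F : V -> 'rV[K]_m.+1) x :
  (forall j, differentiable (fun y => F y 0 j) x) -> differentiable F x.
Proof.
move=> dF.
have -> : F = \sum_(j < m.+1) (fun y => F y 0 j *: delta_mx 0 j).
  by apply/funext => y; rewrite fct_sumE; exact: row_sum_delta.
by apply: differentiable_sum => j; exact: differentiableZl.
Qed.

Section Affine.
Variables (V : normedModType (Cx R)) (F : V -> 'rV[Cx R]_n.+2) (k : 'I_n.+2).

Lemma near_entry_neq0 x : differentiable (fun y => F y 0 k) x ->
  F x 0 k != 0 -> \forall y \near x, F y 0 k != 0.
Proof.
move=> /differentiable_continuous cF Fk.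
exact: (@cvgr_neq0 _ _ _ _ (nbhs_filter x) _ _ cF Fk).
Qed.

(** Near [x] the [k]-th entry stays nonzero, and the affine coordinates are quotients of entries of
    [F]. *)
Lemma differentiable_affine_chart x :
  (forall j, differentiable (fun y => F y 0 j) x) -> F x 0 k != 0 ->
  differentiable (fun y => cmap (affine_chart R k) (proj_point (F y))) x.
Proof.
move=> dF Fk.
apply: (@near_eq_differentiable _ _ _ (fun y => col' k ((F y 0 k)^-1 *: F y))).
  by apply: filterS (near_entry_neq0 (dF k) Fk) => y yk; rewrite affine_chart_map.
apply: differentiable_row => j.
have -> : (fun y => col' k ((F y 0 k)^-1 *: F y) 0 j) =
    (fun y => (F y 0 k)^-1) * (fun y => F y 0 (lift k j)).
  by apply/funext => y; rewrite !mxE.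
by apply: differentiableM => //; exact: differentiableV.
Qed.

End Affine.
End Projective.

(** * The point of the projective line defined by the normal *)

Section StereographicProjection.
Variable R : realType.

(** [spinor0] vanishes exactly at the north pole, where only the second formula has content.
    Elsewhere [key] gives the first formula, and [spinorM] passes from it to the second. *)
Lemma sphere_to_CP1_frame l (x y n : 'rV[R]_3) : conformal_frame l x y n ->
  let f := null_of x y in
  (spinor0 f != 0 ->
     sphere_to_CP1 n = proj_point (row2 (spinor0 f) (f 0 (inord 2)))) /\
  (spinor1 f != 0 ->
     sphere_to_CP1 n = proj_point (row2 (f 0 (inord 2)) (spinor1 f))).
Proof.
move=> fr f; have nullf := null_of_quadric fr.
have key : toCx (1 - n 0 (inord 2)) * f 0 (inord 2) =
    mkCx (n 0 (inord 0)) (n 0 (inord 1)) * spinor0 f.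
  exact: stereographic_spinor0 fr.
have s01 : spinor0 f * spinor1 f = f 0 (inord 2) ^+ 2 := spinorM nullf.
rewrite /sphere_to_CP1; have [n2|n2] := eqVneq (n 0 (inord 2)) 1.
  (* At the pole the unit length leaves n = (0, 0, 1), and x = y × n reads x_0 = y_1, x_1 = -
     y_0. *)
  have s0 : spinor0 f = 0.
    have [l0 xx yy xy nn nx ny dt] := fr.
    have xE := congr1 (fun u : 'rV[R]_3 => u 0 _) (frame_cross_yn fr).
    have yE := frame_cross_nx fr.
    have n01 : n 0 (inord 0) ^+ 2 + n 0 (inord 1) ^+ 2 = 0.
      by move: nn; rewrite dot3E n2; lra.
    have /eqP := n01; rewrite paddr_eq0 ?sqr_ge0 // !sqrf_eq0.
    move=> /andP[/eqP n0 /eqP n1].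
    rewrite /spinor0 /f /null_of !mxE -(xE (inord 0)) -(xE (inord 1)) !cross3E n0 n1 n2.
    by apply: Cx_eqP; rewrite !reimE !reCi !imCi /=; ring.
  split; first by rewrite s0 eqxx.
  have f2 : f 0 (inord 2) = 0.
    by move/eqP: s01; rewrite s0 mul0r eq_sym sqrf_eq0 => /eqP.
  move=> s1; rewrite f2 -(proj_pointZ (row2 0 1) s1) row2Z mulr0 mulr1.
  by [].
have a0 : toCx (1 - n 0 (inord 2)) != 0.
  by apply: contra_neq n2 => /(congr1 (@reC R)) /= /eqP; rewrite subr_eq0 => /eqP.
(* Otherwise [key] gives f_2 = 0, so [x] and [y] are horizontal, differ by a quarter turn, and the
   last component of their cross product is [l], forcing n_2 = 1. *)
have s0 : spinor0 f != 0.
  apply/eqP => s0; move/eqP: key; rewrite s0 mulr0 mulf_eq0 (negPf a0) /= => /eqP f2.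
  have [l0 xx yy xy nn nx ny dt] := fr.
  have x2 : x 0 (inord 2) = 0 by have := congr1 (@reC R) f2; rewrite !mxE.
  have y2 : y 0 (inord 2) = 0.
    by have := congr1 (@imC R) f2; rewrite !mxE /= => /eqP; rewrite oppr_eq0 => /eqP.
  have re0 : x 0 (inord 0) = y 0 (inord 1).
    have := congr1 (@reC R) s0; rewrite /spinor0 !mxE !reimE !reCi !imCi /=; lra.
  have im0 : x 0 (inord 1) = - y 0 (inord 0).
    have := congr1 (@imC R) s0; rewrite /spinor0 !mxE !reimE !reCi !imCi /=; lra.
  have := congr1 (fun u : 'rV[R]_3 => u 0 (inord 2)) (cross3_frame fr).
  rewrite /= !cross3E mxE re0 im0 => ln.
  move: n2; apply/negP/negPn; apply/eqP/(mulfI (lt0r_neq0 l0)).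
  by move: xx yy; rewrite !dot3E x2 y2 re0 im0; lra.
have H0 : proj_point (row2 (toCx (1 - n 0 (inord 2))) (mkCx (n 0 (inord 0)) (n 0 (inord 1)))) =
    proj_point (row2 (spinor0 f) (f 0 (inord 2))).
  have a's0 : toCx (1 - n 0 (inord 2)) / spinor0 f != 0 by rewrite mulf_neq0 // invr_eq0.
  rewrite -(proj_pointZ (row2 (spinor0 f) _) a's0) row2Z divfK //.
  by rewrite mulrAC key mulfK.
split => [_|s1]; rewrite ?H0 //.
have f2 : f 0 (inord 2) != 0 by rewrite -sqrf_eq0 -s01 mulf_neq0.
rewrite -[RHS](proj_pointZ _ (mulf_neq0 s0 (invr_neq0 f2))) row2Z divfK //.
by rewrite mulrAC s01 expr2 mulfK // H0.
Qed.

End StereographicProjection.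

(** * The equivalences *)

Section Equivalences.
Variables (R : realType) (M : riemann_surface R) (phi : M -> 'rV[R]_3).
Hypothesis hphi : conformal_immersion phi.
Implicit Types (c : chart M (Cx R)) (p : M) (z : Cx R).

Local Notation form c := (weier (phi \o cinv c)).

(** Every tangent vector is [of_chart c p * w], so the conditions defining [gauss_map], which range
    over all tangent vectors, amount to conditions on the two coordinate derivatives. *)
Lemma gauss_frame c p : rs_atlas c -> cdom c p ->
  exists l, conformal_frame l (rderive 1 (phi \o cinv c) (cmap c p))
    (rderive 'i (phi \o cinv c) (cmap c p)) (gauss_map phi p).
Proof.
move=> Ac cp; have [l l0 [xx yy xy]] := conformal_chart hphi Ac cp.
have dh : differentiable (realify (phi \o cinv c)) (plane (cmap c p)).
  by apply: phi_differentiable => //; exists p.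
set x := rderive 1 _ _ in xx xy *; set y := rderive 'i _ _ in yy xy *.
have dmapE w : dmap phi p (of_chart c p * w) = reC w *: x + imC w *: y.
  by rewrite dmap_chart // (rderive_lin w dh).
have dmapI w : dmap phi p ('i * (of_chart c p * w)) = - imC w *: x + reC w *: y.
  have -> : 'i * (of_chart c p * w) = of_chart c p * ('i * w) by rewrite mulrCA.
  apply: etrans (dmapE _) _; congr (_ *: x + _ *: y).
    by rewrite reCM reCi imCi; ring.
  by rewrite imCM reCi imCi; ring.
have ofE v : exists w, v = of_chart c p * w.
  exists (to_chart c p * v).
  by rewrite mulrA (to_of_chart hphi Ac cp) mul1r.
have [_ _ _ _ nn nx ny dt] := frame_exists l0 xx yy xy.
have : [set n | [/\ dot3 n n = 1, forall v, dot3 n (dmap phi p v) = 0 &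
    forall v, v != 0 -> 0 < det3 (dmap phi p v) (dmap phi p ('i * v)) n]]
    (gauss_map phi p).
  (* The explicit normal shows that the choice in [gauss_map] does not fall back on the default
     0. *)
  apply: xgetPex; exists (l^-1 *: cross3 x y); split=> [//|v|v v0].
    have [w ->] := ofE v; apply: etrans (congr1 _ (dmapE w)) _.
    by rewrite dot3DZ nx ny !mulr0 addr0.
  have [w vE] := ofE v; rewrite vE in v0 *; rewrite (dmapE w) (dmapI w).
  rewrite det3_rotate mulr_gt0 // lt0r addr_ge0 ?sqr_ge0 // andbT.
  apply: contra_neq v0 => /eqP; rewrite paddr_eq0 ?sqr_ge0 // !sqrf_eq0.
  move=> /andP[/eqP rw /eqP iw].
  by rewrite (_ : w = 0) ?mulr0 //; exact: Cx_eqP.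
move=> [gn gd gdet]; exists l; apply: (ConformalFrame l0 xx yy xy gn).
- by apply: etrans (gd (of_chart c p * 1)); congr dot3; exact/esym/dmap_chart.
- by apply: etrans (gd (of_chart c p * 'i)); congr dot3; exact/esym/dmap_chart.
have := gdet _ (of_chart_neq0 hphi Ac cp).
have d1 : dmap phi p (of_chart c p) = x.
  by apply: etrans (dmap_chart hphi 1 Ac cp); rewrite mulr1.
have di : dmap phi p ('i * of_chart c p) = y.
  by apply: etrans (dmap_chart hphi 'i Ac cp); rewrite mulrC.
by rewrite d1 di.
Qed.

Lemma form_null c p : rs_atlas c -> cdom c p ->
  \sum_i form c (cmap c p) 0 i ^+ 2 = 0.
Proof. by move=> Ac cp; have [l /null_of_quadric] := gauss_frame Ac cp. Qed.

Lemma form_neq0 c p : rs_atlas c -> cdom c p -> form c (cmap c p) != 0.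
Proof. by move=> Ac cp; have [l /null_of_neq0] := gauss_frame Ac cp. Qed.

Lemma form_cdifferentiable c p j : rs_atlas c -> cdom c p ->
  cdifferentiable (fun z => form c z 0 j) (cmap c p).
Proof.
by move=> Ac cp; apply: weier_cdifferentiable (hphi.1 c Ac) _; exists p.
Qed.

Lemma form_dbar c p j : rs_atlas c -> cdom c p ->
  dbar (fun z => form c z 0 j) (cmap c p) =
  toCx (laplacian (phi \o cinv c) (cmap c p) 0 j).
Proof.
move=> Ac cp; have [_ oc _ _ _] := rs_chart Ac.
by apply: (dbar_weier j oc (hphi.1 c Ac)); exists p.
Qed.

Lemma near_chart c p (P : Cx R -> Prop) : rs_atlas c -> cdom c p ->
  (forall q, cdom c q -> P (cmap c q)) -> \forall z \near cmap c p, P z.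
Proof.
by move=> Ac cp HP; apply: filterS (near_cdom Ac cp) => _ [q cq <-]; exact: HP.
Qed.

Lemma holomorphic_formP : holomorphic_form (weierstrass phi) <->
  forall c p j, rs_atlas c -> cdom c p ->
    differentiable (fun z => form c z 0 j) (cmap c p).
Proof.
have E c p : rs_atlas c -> cdom c p -> {near cmap c p,
    (fun z => weierstrass phi (cinv c z) (of_chart c (cinv c z))) =1 form c}.
  move=> Ac cp; apply: near_chart => // q cq; rewrite cinvK //.
  by rewrite -[of_chart c q]mulr1 weierstrass_chart // scale1r.
split=> H c p; last first.
  move=> Ac cp; apply/derivable1_diffP.
  apply: (@near_eq_differentiable _ _ _ (form c)).
    by apply: filterS (E c p Ac cp) => z ->.
  by apply: differentiable_row => j; exact: H.
move=> j Ac cp; have /derivable1_diffP dH := H c p Ac cp.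
have df : differentiable (form c) (cmap c p) := near_eq_differentiable (E c p Ac cp) dH.
exact: differentiable_comp df (differentiable_coord _ 0 j).
Qed.

Lemma harmonic_mapP : harmonic_map phi <->
  forall c p j, rs_atlas c -> cdom c p ->
    dbar (fun z => form c z 0 j) (cmap c p) = 0.
Proof.
split=> H c p.
  by move=> j Ac cp; rewrite form_dbar // H // mxE.
move=> Ac cp; apply/rowP => j; rewrite [RHS]mxE.
by have := H c p j Ac cp; rewrite form_dbar // => /(congr1 (@reC R)).
Qed.

Lemma harmonic_iff_holomorphic_form :
  harmonic_map phi <-> holomorphic_form (weierstrass phi).
Proof.
split=> [/harmonic_mapP H|/holomorphic_formP H].
  apply/holomorphic_formP => c p j Ac cp; apply/derivable1_diffP.
  by apply: dbar_derivable; [exact: form_cdifferentiable|exact: H].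
apply/harmonic_mapP => c p j Ac cp.
by have /derivable1_diffP/derivable_dbar[] := H c p j Ac cp.
Qed.

Lemma mean_curvature_eq0 c p : rs_atlas c -> cdom c p ->
  mean_curvature phi c p = 0 <->
  dot3 (laplacian (phi \o cinv c) (cmap c p)) (gauss_map phi p) = 0.
Proof.
move=> Ac cp; have [l fr] := gauss_frame Ac cp.
exact: (frame_curvature_eq0 _ _ _ fr).
Qed.

Lemma minimal_harmonic : minimal_immersion phi -> harmonic_map phi.
Proof.
move=> min c p Ac cp; have [l fr] := gauss_frame Ac cp.
have lapn := (mean_curvature_eq0 Ac cp).1 (min c p Ac cp).
have D j := form_cdifferentiable j Ac cp.
have DM j : cdifferentiable (fun z => form c z 0 j * form c z 0 j) (cmap c p).
  exact: (cderiveM 1 (D j) (D j)).1.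
have DD : cdifferentiable (fun z => form c z 0 (inord 0) * form c z 0 (inord 0) +
    form c z 0 (inord 1) * form c z 0 (inord 1)) (cmap c p).
  exact: (cderiveD 1 (DM _) (DM _)).1.
have E0 : dbar (fun z => form c z 0 (inord 0) * form c z 0 (inord 0) +
    form c z 0 (inord 1) * form c z 0 (inord 1) +
    form c z 0 (inord 2) * form c z 0 (inord 2)) (cmap c p) = 0.
  apply: etrans (dbar_cst 0 (cmap c p)); apply: near_eq_dbar.
  apply: near_chart => // q cq; have := form_null Ac cq.
  by rewrite sum3E !expr2.
set lap := laplacian (phi \o cinv c) (cmap c p) in lapn *.
have Esum : 2 * \sum_i form c (cmap c p) 0 i * toCx (lap 0 i) = 0.
  have DE j : dbar (fun z => form c z 0 j * form c z 0 j) (cmap c p) =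
      2 * (form c (cmap c p) 0 j * toCx (lap 0 j)).
    by rewrite (dbarM (D j) (D j)) form_dbar // mulr2n mulrDl mul1r.
  by rewrite -[RHS]E0 (dbarD DD (DM _)) (dbarD (DM _) (DM _)) !DE sum3E !mulrDr.
move/eqP: Esum; rewrite mulf_eq0 pnatr_eq0 /= => /eqP.
(* The Laplacian is real, so the real and imaginary parts of this product are, up to sign, its
   products with the two tangent vectors. *)
rewrite null_dot => E.
apply: (frame_span fr) => //; first exact: (congr1 (@reC R) E).
by have /eqP := congr1 (@imC R) E; rewrite oppr_eq0 => /eqP.
Qed.

End Equivalences.

(** * Holomorphic lifts, and the bundle map of a holomorphic form *)

Section Holomorphy.
Variable R : realType.

Section Lift.
Variables (V : normedModType (Cx R)) (T : Type) (A : set (chart T V)).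

(** In any affine chart met by the map, its coordinates are quotients of entries of the lift [G],
    hence complex differentiable. *)
Lemma holomorphic_lift n (F : T -> set 'rV[Cx R]_n.+2) :
  (forall p c, A c -> cdom c p -> exists G : V -> 'rV[Cx R]_n.+2,
    [/\ G (cmap c p) != 0, F p = proj_point (G (cmap c p)) &
      \forall z \near cmap c p, F (cinv c z) = proj_point (G z) /\
        forall j, differentiable (fun y => G y 0 j) z]) ->
  holomorphic A (@proj_atlas R n) F.
Proof.
move=> H p c Ac cp; have [G [G0 FE nG]] := H p c Ac cp.
split.
  have [k Gk] := ex_affine_chart G0; exists (affine_chart R k).
  by split; [exists k|rewrite FE; apply/affine_chart_dom].
move=> _ [k _ <-]; rewrite FE => /affine_chart_dom Gk.
have dG j : differentiable (fun y => G y 0 j) (cmap c p).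
  exact: (nbhs_singleton nG).2.
have nk := near_entry_neq0 (dG k) Gk.
(* Differentiability is required at every nearby [z], so [F] and the lift must agree on a
   neighbourhood of each such [z]; [near_join] provides it. *)
apply: filterS3 (near_join nG) nG nk => z nGz [Fz dGz] Gzk; split.
  by rewrite Fz; apply/affine_chart_dom.
apply: near_eq_differentiable (differentiable_affine_chart dGz Gzk).
by apply: filterS nGz => y [Fy _]; rewrite -Fy.
Qed.

Lemma holomorphic_id_atlas (W : normedModType (Cx R)) (F : T -> W) :
  (forall p c, A c -> cdom c p ->
    \forall z \near cmap c p, differentiable (F \o cinv c) z) ->
  holomorphic A (@id_atlas W) F.
Proof.
move=> H p c Ac cp; split; first by exists (Chart setT id id).
by move=> _ -> _; apply: filterS (H p c Ac cp) => z dz; split.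
Qed.

Lemma holomorphic_pair (T1 T2 : Type) (V1 V2 : normedModType (Cx R))
    (B1 : set (chart T1 V1)) (B2 : set (chart T2 V2)) F1 F2 :
  holomorphic A B1 F1 -> holomorphic A B2 F2 ->
  holomorphic A (prod_atlas B1 B2) (fun p => (F1 p, F2 p)).
Proof.
move=> H1 H2 p c Ac cp.
have [[d1 [Bd1 d1F]] K1] := H1 p c Ac cp.
have [[d2 [Bd2 d2F]] K2] := H2 p c Ac cp.
split; first by exists (prod_chart d1 d2); split; [exists d1, d2|].
move=> _ [e1 [e2 [Be1 Be2 ->]]] [/= e1F e2F].
apply: filterS2 (K1 _ Be1 e1F) (K2 _ Be2 e2F) => z [z1 dz1] [z2 dz2].
by split; [split|exact: differentiable_pair].
Qed.

End Lift.

Lemma differentiable_fst (K : numFieldType) (V W : normedModType K) (x : V * W) :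
  differentiable (fst : V * W -> V) x.
Proof.
by apply: (@linear_differentiable _ _ _ (fst : {linear (V * W)%type -> V})) => y; exact: cvg_fst.
Qed.

Lemma differentiable_snd (K : numFieldType) (V W : normedModType K) (x : V * W) :
  differentiable (snd : V * W -> W) x.
Proof.
by apply: (@linear_differentiable _ _ _ (snd : {linear (V * W)%type -> W})) => y; exact: cvg_snd.
Qed.

Lemma near_fst (V W : topologicalType) (P : V -> Prop) (x : V * W) :
  (\forall y \near x.1, P y) -> \forall y \near x, P y.1.
Proof. by case: x => a b; exact: cvg_fst. Qed.

Variables (M : riemann_surface R) (phi : M -> 'rV[R]_3).
Hypothesis hphi : conformal_immersion phi.
Implicit Types (c : chart M (Cx R)) (p : M) (z : Cx R).

Local Notation form c := (weier (phi \o cinv c)).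

Lemma conic_eta p : conic (eta_map phi p).
Proof.
have [c [Ac cp]] := rs_cover p.
exists (form c (cmap c p)); last by rewrite (eta_chart hphi Ac cp).
by split; [rewrite /null_quadric /=; exact (form_null hphi Ac cp)|exact: (form_neq0 hphi Ac cp)].
Qed.

Lemma near_eta c p : rs_atlas c -> cdom c p ->
  \forall z \near cmap c p, eta_map phi (cinv c z) = proj_point (form c z).
Proof.
move=> Ac cp; apply: near_chart => // q cq.
by rewrite cinvK //; exact: eta_chart.
Qed.

Lemma near_form_differentiable c p : holomorphic_form (weierstrass phi) ->
  rs_atlas c -> cdom c p ->
  \forall z \near cmap c p, forall j, differentiable (fun y => form c y 0 j) z.
Proof.
move=> /(holomorphic_formP hphi) H Ac cp; apply: near_chart => // q cq j.
exact: H.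
Qed.

Lemma holomorphic_form_bundle_map : holomorphic_form (weierstrass phi) ->
  holomorphic_bundle_map phi.
Proof.
move=> H; split; split.
- exact: conic_eta.
- apply: holomorphic_lift => p c Ac cp; exists (form c); split.
  + exact (form_neq0 hphi Ac cp).
  + exact: eta_chart.
  + exact: filterI (near_eta Ac cp) (near_form_differentiable H Ac cp).
- by move=> [p v]; split; [exact: conic_eta|exists v].
apply: holomorphic_pair.
  apply: holomorphic_lift => -[p v] _ [c Ac <-] /= cp.
  exists (fun y => form c y.1); split; rewrite ?[cmap _ _]/=.
  + exact (form_neq0 hphi Ac cp).
  + exact (eta_chart hphi Ac cp).
  + have nE := near_fst (x := cmap (tangent_chart c) (p, v)) (near_eta Ac cp).
    have nD := near_fst (x := cmap (tangent_chart c) (p, v))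
      (near_form_differentiable H Ac cp).
    apply: filterS2 nE nD => y yE yD; split=> [|j]; first exact: yE.
    exact: differentiable_comp (differentiable_fst y) (yD j).
apply: holomorphic_id_atlas => -[p v] _ [c Ac <-] /= cp.
(* In the tangent chart the fibre coordinate w stands for the vector [of_chart c p * w], so the
   second component reads as the product w f(z). *)
have nW : \forall y \near (cmap c p, to_chart c p * v),
    y.2 *: form c y.1 = weierstrass phi (cinv c y.1) (of_chart c (cinv c y.1) * y.2).
  have n1 : \forall z \near cmap c p, forall w,
      w *: form c z = weierstrass phi (cinv c z) (of_chart c (cinv c z) * w).
    by apply: near_chart => // q cq w; rewrite cinvK // weierstrass_chart.
  by apply: filterS (near_fst (x := (cmap c p, to_chart c p * v)) n1) => y.
have nD := near_fst (x := cmap (tangent_chart c) (p, v))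
  (near_form_differentiable H Ac cp).
apply: filterS2 (near_join nW) nD => y nWy yD.
apply: near_eq_differentiable nWy _; apply: differentiable_row => j.
have -> : (fun z : Cx R * Cx R => (z.2 *: form c z.1) 0 j) = snd * ((fun z => form c z 0 j) \o fst).
  by apply/funext => z; rewrite mxE.
apply: differentiableM; first exact: differentiable_snd.
exact: differentiable_comp (differentiable_fst y) (yD j).
Qed.

End Holomorphy.

(** * Lifts of the Gauss map by spinors *)

Section Spinors.
Variable R : realType.
Implicit Types f : 'rV[Cx R]_3.

Lemma spinor0Z a f : spinor0 (a *: f) = a * spinor0 f.
Proof. by rewrite /spinor0 !mxE; ring. Qed.

Lemma spinor1Z a f : spinor1 (a *: f) = a * spinor1 f.
Proof. by rewrite /spinor1 !mxE; ring. Qed.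

Lemma spinor_entry0 f : f 0 (inord 0) = (spinor0 f - spinor1 f) / 2.
Proof.
rewrite /spinor0 /spinor1; move: (f 0 (inord 0)) (f 0 (inord 1)) => a b.
have -> : a - 'i * b - (- a - 'i * b) = a * 2 by ring.
by rewrite mulfK // pnatr_eq0.
Qed.

Lemma spinor_entry1 f : f 0 (inord 1) = 'i * (spinor0 f + spinor1 f) / 2.
Proof.
rewrite /spinor0 /spinor1; move: (f 0 (inord 0)) (f 0 (inord 1)) => a b.
have -> : 'i * (a - 'i * b + (- a - 'i * b)) = - ('i * 'i) * b * 2 by ring.
by rewrite Cxi2 opprK mul1r mulfK // pnatr_eq0.
Qed.

(** The two homogeneous pairs for the Gauss map, both linear in [f]. The usable pivot is entry 0
    here and entry 1, written [lift 0 0], in [spinor_row1]. *)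
Definition spinor_row0 f : 'rV[Cx R]_2 := row2 (spinor0 f) (f 0 (inord 2)).
Definition spinor_row1 f : 'rV[Cx R]_2 := row2 (f 0 (inord 2)) (spinor1 f).

Lemma spinor_row0_entry f : (spinor_row0 f 0 0 = spinor0 f) *
  (spinor_row0 f 0 (lift 0 0) = f 0 (inord 2)).
Proof. by rewrite !mxE. Qed.

Lemma spinor_row1_entry f : (spinor_row1 f 0 (lift 0 0) = spinor1 f) *
  (spinor_row1 f 0 0 = f 0 (inord 2)).
Proof. by rewrite !mxE. Qed.

Lemma ord2P (P : 'I_2 -> Prop) : P 0 -> P (lift 0 0) -> forall j, P j.
Proof.
move=> P0 P1 j; have [i ->|->] := unliftP 0 j; last exact: P0.
by rewrite (ord1 i).
Qed.

Section SpinorDifferentiable.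
Variables (G : Cx R -> 'rV[Cx R]_3) (z : Cx R).
Hypothesis dG : forall j, differentiable (fun y => G y 0 j) z.

Lemma spinor_row0_differentiable j : differentiable (fun y => spinor_row0 (G y) 0 j) z.
Proof.
move: j; apply: ord2P.
  have -> : (fun y => spinor_row0 (G y) 0 0) =
      (fun y => G y 0 (inord 0)) - 'i *: (fun y => G y 0 (inord 1)).
    by apply/funext => y; rewrite spinor_row0_entry.
  by apply: differentiableB; [exact: dG|apply: differentiableZ; exact: dG].
have -> : (fun y => spinor_row0 (G y) 0 (lift 0 0)) = (fun y => G y 0 (inord 2)).
  by apply/funext => y; rewrite spinor_row0_entry.
exact: dG.
Qed.

Lemma spinor_row1_differentiable j : differentiable (fun y => spinor_row1 (G y) 0 j) z.
Proof.
move: j; apply: ord2P; last first.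
  have -> : (fun y => spinor_row1 (G y) 0 (lift 0 0)) =
      - (fun y => G y 0 (inord 0)) - 'i *: (fun y => G y 0 (inord 1)).
    by apply/funext => y; rewrite spinor_row1_entry.
  by apply: differentiableB; [apply: differentiableN|apply: differentiableZ]; exact: dG.
have -> : (fun y => spinor_row1 (G y) 0 0) = (fun y => G y 0 (inord 2)).
  by apply/funext => y; rewrite spinor_row1_entry.
exact: dG.
Qed.

End SpinorDifferentiable.
End Spinors.

(** * From the bundle map to the Gauss map *)

Section GaussMap.
Variables (R : realType) (M : riemann_surface R) (phi : M -> 'rV[R]_3).
Hypothesis hphi : conformal_immersion phi.
Implicit Types (c : chart M (Cx R)) (p : M) (z : Cx R).

Local Notation form c := (weier (phi \o cinv c)).
Local Notation gauss := (@sphere_to_CP1 R \o gauss_map phi).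

Lemma gauss_spinor0 c p : rs_atlas c -> cdom c p -> spinor0 (form c (cmap c p)) != 0 ->
  gauss p = proj_point (spinor_row0 (form c (cmap c p))).
Proof.
move=> Ac cp; have [l fr] := gauss_frame hphi Ac cp.
exact (sphere_to_CP1_frame fr).1.
Qed.

Lemma gauss_spinor1 c p : rs_atlas c -> cdom c p -> spinor1 (form c (cmap c p)) != 0 ->
  gauss p = proj_point (spinor_row1 (form c (cmap c p))).
Proof.
move=> Ac cp; have [l fr] := gauss_frame hphi Ac cp.
exact (sphere_to_CP1_frame fr).2.
Qed.

Lemma spinor_cases c p : rs_atlas c -> cdom c p ->
  spinor0 (form c (cmap c p)) != 0 \/ spinor1 (form c (cmap c p)) != 0.
Proof.
move=> Ac cp; have [s0|] := eqVneq (spinor0 (form c (cmap c p))) 0; last by left.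
right; apply/eqP => s1; have /eqP := form_neq0 hphi Ac cp; apply.
exact: spinor_eq0 (form_null hphi Ac cp) s0 s1.
Qed.

(** Holomorphy of [eta] controls only the line through [f]. Dividing [f] by a nonzero entry gives
    the normalized vector, whose entries are 1 and the affine coordinates of [eta]. *)
Lemma eta_local_lift c p : holomorphic (@rs_atlas R M) (@proj_atlas R 1) (eta_map phi) ->
  rs_atlas c -> cdom c p -> exists a : Cx R -> Cx R,
  \forall z \near cmap c p, a z != 0 /\
    forall j, differentiable (fun y => (a y *: form c y) 0 j) z.
Proof.
move=> H Ac cp; have [k fk] := ex_affine_chart (form_neq0 hphi Ac cp).
exists (fun y => (form c y 0 k)^-1).
have etaE := eta_chart hphi Ac cp.
have Bk : @proj_atlas R 1 (affine_chart R k) by exists k.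
have dk : cdom (affine_chart R k) (eta_map phi p).
  by rewrite etaE; apply/affine_chart_dom.
have nH : \forall z \near cmap c p,
    cdom (affine_chart R k) (eta_map phi (cinv c z)) /\
    differentiable (cmap (affine_chart R k) \o eta_map phi \o cinv c) z.
  exact ((H p c Ac cp).2 _ Bk dk).
have nE := near_eta hphi Ac cp.
have nk : \forall z \near cmap c p, eta_map phi (cinv c z) = proj_point (form c z) /\
    form c z 0 k != 0.
  apply: filterS2 nH nE => z [dz _] zE; split; first exact: zE.
  by apply/affine_chart_dom; rewrite -zE.
apply: filterS3 nH (near_join nk) nk => z [_ dz] nkz [_ kz].
split; first by rewrite invr_eq0.
move=> j; have [i ->|->] := unliftP k j; last first.
  apply: near_eq_differentiable (differentiable_cst (1 : Cx R) z).
  by apply: filterS nkz => y [_ ky]; rewrite mxE mulVf.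
apply: near_eq_differentiable (differentiable_comp dz (differentiable_coord _ 0 i)).
apply: filterS nkz => y [yE ky].
have E : cmap (affine_chart R k) (eta_map phi (cinv c y)) =
    col' k ((form c y 0 k)^-1 *: form c y).
  by rewrite yE affine_chart_map.
by apply: etrans (congr1 (fun u : 'rV[Cx R]_2 => u 0 i) E) _; rewrite mxE.
Qed.

(** Treats both spinor rows at once. Since [row] commutes with scalars, the rescaled [f] defines the
    same projective point, and its row is the required differentiable lift. *)
Lemma gauss_lift c p (row : 'rV[Cx R]_3 -> 'rV[Cx R]_2) i (a : Cx R -> Cx R) :
  (forall b f, row (b *: f) = b *: row f) ->
  (forall (G : Cx R -> 'rV[Cx R]_3) z, (forall j, differentiable (fun y => G y 0 j) z) ->
     forall j, differentiable (fun y => row (G y) 0 j) z) ->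
  (forall q, cdom c q -> row (form c (cmap c q)) 0 i != 0 ->
     gauss q = proj_point (row (form c (cmap c q)))) ->
  rs_atlas c -> cdom c p -> row (form c (cmap c p)) 0 i != 0 ->
  (\forall z \near cmap c p, a z != 0 /\
    forall j, differentiable (fun y => (a y *: form c y) 0 j) z) ->
  exists G : Cx R -> 'rV[Cx R]_2,
    [/\ G (cmap c p) != 0, gauss p = proj_point (G (cmap c p)) &
      \forall z \near cmap c p, gauss (cinv c z) = proj_point (G z) /\
        forall j, differentiable (fun y => G y 0 j) z].
Proof.
move=> rowZ rowd rowg Ac cp rp na; exists (fun y => row (a y *: form c y)).
have [ap dap] := nbhs_singleton na.
have rap : row (a (cmap c p) *: form c (cmap c p)) 0 i != 0.
  by rewrite rowZ mxE mulf_neq0.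
split.
- by apply: contraNneq rap => ->; rewrite mxE.
- by rewrite rowZ (proj_pointZ _ ap); exact: rowg.
have nr := near_entry_neq0 (F := fun y => row (a y *: form c y)) (rowd _ _ dap i) rap.
have ng : \forall z \near cmap c p, row (form c z) 0 i != 0 ->
    gauss (cinv c z) = proj_point (row (form c z)).
  by apply: (near_chart Ac cp) => q cq; rewrite (cinvK Ac cq); exact: rowg.
apply: filterS3 na nr ng => z [az daz] rz gz; split; last exact: rowd.
move: rz; rewrite !rowZ (proj_pointZ _ az) mxE mulf_eq0 negb_or => /andP[_ rz].
exact: gz.
Qed.

Lemma bundle_map_gauss_map : holomorphic_bundle_map phi -> holomorphic_gauss_map phi.
Proof.
move=> [[_ H] _]; split=> [p|].
  have [c [Ac cp]] := rs_cover p.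
  by have [l fr] := gauss_frame hphi Ac cp; exact: (frame_n fr).
apply: holomorphic_lift => p c Ac cp; have [a na] := eta_local_lift H Ac cp.
have [s|s] := spinor_cases Ac cp.
  apply: (gauss_lift (row := @spinor_row0 R) (i := 0) _ _ _ Ac cp _ na).
  - by move=> b f; rewrite /spinor_row0 row2Z spinor0Z mxE.
  - exact: spinor_row0_differentiable.
  - by move=> q cq; rewrite spinor_row0_entry; exact: gauss_spinor0.
  - by rewrite spinor_row0_entry.
apply: (gauss_lift (row := @spinor_row1 R) (i := lift 0 0) _ _ _ Ac cp _ na).
- by move=> b f; rewrite /spinor_row1 row2Z spinor1Z mxE.
- exact: spinor_row1_differentiable.
- by move=> q cq; rewrite spinor_row1_entry; exact: gauss_spinor1.
- by rewrite spinor_row1_entry.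
Qed.

End GaussMap.

(** * Rational parametrization of null vectors *)

Section NullParametrization.
Variable R : realType.
Implicit Types (f : 'rV[Cx R]_3) (t e : Cx R).

(* A null vector [f] is [spinor0 f] times this for [e = 1], [t = f_2 / spinor0 f],
   and [spinor1 f] times this for [e = -1], [t = f_2 / spinor1 f]. *)
Definition null_param e t (j : 'I_3) : Cx R :=
  nth 0 [:: e / 2 - e / 2 * (t * t); 'i / 2 + 'i / 2 * (t * t); t] j.

(** With t = f_2 / [spinor0 f], [spinorM] gives [spinor1 f] = [spinor0 f] t^2, and the first two
    entries are linear in the spinors. *)
Lemma null_param0 f j : \sum_i f 0 i ^+ 2 = 0 -> spinor0 f != 0 ->
  f 0 j = spinor0 f * null_param 1 (f 0 (inord 2) / spinor0 f) j.
Proof.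
move=> /spinorM s01 s0.
have s1E : spinor1 f = spinor0 f * (f 0 (inord 2) / spinor0 f) ^+ 2.
  by apply: (mulfI s0); rewrite s01; field.
have e0 := spinor_entry0 f; have e1 := spinor_entry1 f.
set t := f 0 (inord 2) / spinor0 f in s1E *.
have e2 : f 0 (inord 2) = spinor0 f * t by rewrite /t mulrC divfK.
rewrite -(inord_val j) /null_param; case: j => -[|[|[|//]]] i3; rewrite /= inordK //=.
- by rewrite e0 s1E; field.
- by rewrite e1 s1E; field.
Qed.

Lemma null_param1 f j : \sum_i f 0 i ^+ 2 = 0 -> spinor1 f != 0 ->
  f 0 j = spinor1 f * null_param (-1) (f 0 (inord 2) / spinor1 f) j.
Proof.
move=> /spinorM s01 s1.
have s0E : spinor0 f = spinor1 f * (f 0 (inord 2) / spinor1 f) ^+ 2.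
  by apply: (mulIf s1); rewrite s01; field.
have e0 := spinor_entry0 f; have e1 := spinor_entry1 f.
set t := f 0 (inord 2) / spinor1 f in s0E *.
have e2 : f 0 (inord 2) = spinor1 f * t by rewrite /t mulrC divfK.
rewrite -(inord_val j) /null_param; case: j => -[|[|[|//]]] i3; rewrite /= inordK //=.
- by rewrite e0 s0E; field.
- by rewrite e1 s0E; field.
Qed.

Lemma differentiable_null_param e (g : Cx R -> Cx R) z j : differentiable g z ->
  differentiable (fun w => null_param e (g w) j) z.
Proof.
move=> dg; have dgg : differentiable (g * g) z by exact: differentiableM.
case: j => -[|[|[|//]]] i3; rewrite /null_param /=.
- apply: (differentiableB (differentiable_cst (e / 2) z) (differentiableZ (e / 2) dgg)).
- apply: (differentiableD (differentiable_cst ('i / 2) z) (differentiableZ ('i / 2) dgg)).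
- exact: dg.
Qed.

End NullParametrization.

(** * From the Gauss map to minimality *)

Section GaussMapConverse.
Variables (R : realType) (M : riemann_surface R) (phi : M -> 'rV[R]_3).
Hypothesis hphi : conformal_immersion phi.
Implicit Types (c : chart M (Cx R)) (p : M) (z : Cx R).

Local Notation form c := (weier (phi \o cinv c)).
Local Notation gauss := (@sphere_to_CP1 R \o gauss_map phi).

(** The factor [a] is only real differentiable, so [nu] is an unknown complex number; what counts is
    that every complex multiple of [f] is orthogonal to the normal. *)
Lemma proportional_normal c p (a : Cx R -> Cx R) (q : 'I_3 -> Cx R -> Cx R) :
  rs_atlas c -> cdom c p -> cdifferentiable a (cmap c p) -> a (cmap c p) != 0 ->
  (forall j, differentiable (q j) (cmap c p)) ->
  (\forall z \near cmap c p, forall j, form c z 0 j = a z * q j z) ->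
  dot3 (laplacian (phi \o cinv c) (cmap c p)) (gauss_map phi p) = 0.
Proof.
move=> Ac cp da a0 dq nf; have [l fr] := gauss_frame hphi Ac cp.
set lap := laplacian _ _; set n := gauss_map phi p in fr *.
pose nu := dbar a (cmap c p) / a (cmap c p).
have lapE j : toCx (lap 0 j) = nu * form c (cmap c p) 0 j.
  apply: etrans (esym (form_dbar hphi j Ac cp)) _.
  have /derivable1_diffP/derivable_dbar[cq dbq] := dq j.
  have nj : {near cmap c p, (fun z => form c z 0 j) =1 (fun z => a z * q j z)}.
    by apply: filterS nf => z; apply.
  apply: etrans (near_eq_dbar nj) _.
  apply: etrans (dbarM da cq) _; rewrite dbq (nbhs_singleton nj) /nu mulr0 add0r.
  by rewrite mulrA divfK // mulrC.
have E : \sum_i form c (cmap c p) 0 i * toCx (n 0 i) = 0.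
  exact: frame_null_dot fr.
have : toCx (dot3 lap n) = 0.
  rewrite dot3E !toCxD !toCxM !lapE -!mulrA -!mulrDr.
  by rewrite sum3E in E; rewrite E !mulr0.
by move=> h; exact: (congr1 (@reC R) h).
Qed.

(** The quotient is the coordinate of the Gauss map in the affine chart with pivot [i]; [lift i 0]
    is the other index of ['I_2]. *)
Lemma gauss_local_quotient c p (row : 'rV[Cx R]_3 -> 'rV[Cx R]_2) i :
  holomorphic (@rs_atlas R M) (@proj_atlas R 0) gauss ->
  (forall q, cdom c q -> row (form c (cmap c q)) 0 i != 0 ->
     gauss q = proj_point (row (form c (cmap c q)))) ->
  rs_atlas c -> cdom c p -> row (form c (cmap c p)) 0 i != 0 ->
  (\forall z \near cmap c p, row (form c z) 0 i != 0) ->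
  differentiable (fun z => row (form c z) 0 (lift i 0) / row (form c z) 0 i)
    (cmap c p).
Proof.
move=> H rowg Ac cp rp nr.
have Bi : @proj_atlas R 0 (affine_chart R i) by exists i.
have di : cdom (affine_chart R i) (gauss p).
  by rewrite (rowg _ cp rp); apply/affine_chart_dom.
have nH : \forall z \near cmap c p,
    cdom (affine_chart R i) (gauss (cinv c z)) /\
    differentiable (cmap (affine_chart R i) \o gauss \o cinv c) z.
  exact ((H p c Ac cp).2 _ Bi di).
have dz := (nbhs_singleton nH).2.
apply: near_eq_differentiable (differentiable_comp dz (differentiable_coord _ 0 0)).
have ng : \forall z \near cmap c p, row (form c z) 0 i != 0 ->
    gauss (cinv c z) = proj_point (row (form c z)).
  by apply: (near_chart Ac cp) => q cq; rewrite (cinvK Ac cq); exact: rowg.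
apply: filterS2 ng nr => y gy ry.
have E : cmap (affine_chart R i) (gauss (cinv c y)) =
    col' i ((row (form c y) 0 i)^-1 *: row (form c y)).
  by rewrite (gy ry) (affine_chart_map ry).
apply: etrans (congr1 (fun u : 'rV[Cx R]_1 => u 0 0) E) _.
by rewrite !mxE mulrC.
Qed.

Lemma cdifferentiable_spinor0 c p : rs_atlas c -> cdom c p ->
  cdifferentiable (fun z => spinor0 (form c z)) (cmap c p).
Proof.
move=> Ac cp; have D j := form_cdifferentiable hphi j Ac cp.
have := (cderiveD 1 (D (inord 0)) (cderiveM 1 (cderive_cst (- 'i) _ 1).1 (D (inord 1))).1).1.
by congr cdifferentiable; apply/funext => z; rewrite /spinor0 mulNr.
Qed.

Lemma cdifferentiable_spinor1 c p : rs_atlas c -> cdom c p ->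
  cdifferentiable (fun z => spinor1 (form c z)) (cmap c p).
Proof.
move=> Ac cp; have D j := form_cdifferentiable hphi j Ac cp.
have := (cderiveD 1 (cderiveM 1 (cderive_cst (- 1) _ 1).1 (D (inord 0))).1
  (cderiveM 1 (cderive_cst (- 'i) _ 1).1 (D (inord 1))).1).1.
by congr cdifferentiable; apply/funext => z; rewrite /spinor1 !mulNr mul1r.
Qed.

(** One of the real and imaginary parts is nonzero at [z], and it stays so nearby by real
    continuity. *)
Lemma near_cdifferentiable_neq0 (a : Cx R -> Cx R) z :
  cdifferentiable a z -> a z != 0 -> \forall w \near z, a w != 0.
Proof.
move=> [/differentiable_continuous cr /differentiable_continuous ci] az.
have near_part (h : Cx R -> R) : {for plane z, continuous (realify h)} ->
    h z != 0 -> \forall w \near z, h w != 0.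
  move=> ch hz.
  have rz : realify h (plane z) != 0 by rewrite realify_plane.
  have := near_plane (@cvgr_neq0 _ _ _ _ (nbhs_filter (plane z)) _ _ ch rz).
  by apply: filterS => w; rewrite realify_plane.
have [re0|re0] := eqVneq (reC (a z)) 0; last first.
  apply: filterS (near_part _ cr re0) => w.
  by apply: contra_neq => aw; rewrite /= aw.
have im0 : imC (a z) != 0 by apply: contra_neq az => im0; exact: Cx_eqP.
apply: filterS (near_part _ ci im0) => w.
by apply: contra_neq => aw; rewrite /= aw.
Qed.

Lemma gauss_map_minimal : holomorphic_gauss_map phi -> minimal_immersion phi.
Proof.
move=> [_ H] c p Ac cp; apply/(mean_curvature_eq0 hphi Ac cp).
have nullf : \forall z \near cmap c p, \sum_i form c z 0 i ^+ 2 = 0.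
  by apply: (near_chart Ac cp) => q cq; exact (form_null hphi Ac cq).
have [s|s] := spinor_cases hphi Ac cp.
  have da := cdifferentiable_spinor0 Ac cp.
  have na := near_cdifferentiable_neq0 da s.
  have dg : differentiable (fun z => form c z 0 (inord 2) / spinor0 (form c z)) (cmap c p).
    have -> : (fun z => form c z 0 (inord 2) / spinor0 (form c z)) =
        (fun z => spinor_row0 (form c z) 0 (lift 0 0) / spinor_row0 (form c z) 0 0).
      by apply/funext => z; rewrite !spinor_row0_entry.
    apply: (gauss_local_quotient H _ Ac cp).
    - by move=> q cq; rewrite spinor_row0_entry; exact: gauss_spinor0.
    - by rewrite spinor_row0_entry.
    - by apply: filterS na => z; rewrite spinor_row0_entry.
  apply: (proportional_normal Ac cp da s (fun j => differentiable_null_param 1 j dg)).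
  by apply: filterS2 nullf na => z nz az j; exact: null_param0.
have da := cdifferentiable_spinor1 Ac cp.
have na := near_cdifferentiable_neq0 da s.
have dg : differentiable (fun z => form c z 0 (inord 2) / spinor1 (form c z)) (cmap c p).
  have -> : (fun z => form c z 0 (inord 2) / spinor1 (form c z)) =
      (fun z => spinor_row1 (form c z) 0 (lift (lift 0 0) 0) /
        spinor_row1 (form c z) 0 (lift 0 0)).
    apply/funext => z; have -> : lift (lift 0 0) 0 = 0 :> 'I_2 by exact: val_inj.
    by rewrite !spinor_row1_entry.
  apply: (gauss_local_quotient H _ Ac cp).
  - by move=> q cq; rewrite spinor_row1_entry; exact: gauss_spinor1.
  - by rewrite spinor_row1_entry.
  - by apply: filterS na => z; rewrite spinor_row1_entry.
apply: (proportional_normal Ac cp da s (fun j => differentiable_null_param (-1) j dg)).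
by apply: filterS2 nullf na => z nz az j; exact: null_param1.
Qed.

End GaussMapConverse.

Theorem proposition8 (R : realType) (M : riemann_surface R)
    (phi : M -> 'rV[R]_3) (hphi : conformal_immersion phi) :
  [<-> minimal_immersion phi;
       harmonic_map phi;
       holomorphic_form (weierstrass phi);
       holomorphic_bundle_map phi;
       holomorphic_gauss_map phi].
Proof.
tfae.
- exact: minimal_harmonic.
- by move/(harmonic_iff_holomorphic_form hphi).
- exact: holomorphic_form_bundle_map.
- exact: bundle_map_gauss_map.
- exact: gauss_map_minimal.
Qed.
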